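(* Let $(G,\mu,\sigma)$ be a finite weighted graph with vertex measure $\mu$ and signature $\sigma:E^{or}\to H$, where $H=O(d)$ or $U(d)$, satisfying $CD^\sigma(0,\infty)$, and let $N=|V|$. Then for all $1\le k\le N$, $$\sqrt{\lambda^\sigma_{kd}}\le 4\sqrt{D_G^{nor}}\left(kd\sqrt{\log(2kd)}\right)h_k^\sigma .$$
   Context: $G=(V,E,w)$ is a finite undirected simple graph with edge weights $w_{xy}=w_{yx}>0$ for $\{x,y\}\in E$ (and $w_{xy}=0$ otherwise); $x\sim y$ means $\{x,y\}\in E$; $\mu:V\to(0,\infty)$; $E^{or}=\{(x,y),(y,x)\mid\{x,y\}\in E\}$. $\mathbb{K}=\mathbb{R}$ if $H=O(d)$, $\mathbb{K}=\mathbb{C}$ if $H=U(d)$. A signature is a map $\sigma:E^{or}\to H$ with $\sigma_{yx}=\sigma_{xy}^{-1}$. Put $D_G^{nor}=\max_{x\in V}\max_{y\sim x}\frac{\mu(x)}{w_{xy}}$ ($E\ne\emptyset$). For $u:V\to\mathbb{K}$, $\Delta u(x)=\frac1{\mu(x)}\sum_{y\sim x}w_{xy}(u(y)-u(x))$; for $f:V\to\mathbb{K}^d$, $\Delta^\sigma f(x)=\frac1{\mu(x)}\sum_{y\sim x}w_{xy}(\sigma_{xy}f(y)-f(x))$. A number $\lambda$ is an eigenvalue of $\Delta^\sigma$ if $\Delta^\sigma f=-\lambda f$ for some $f\ne0$; the eigenvalues are real nonnegative and listed with multiplicity as $0\le\lambda_1^\sigma\le\cdots\le\lambda_{Nd}^\sigma$.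 Define $2\Gamma^\sigma(f,g)=\Delta(f^T\overline g)-f^T(\overline{\Delta^\sigma g})-(\Delta^\sigma f)^T\overline g$ and $2\Gamma_2^\sigma(f,g)=\Delta\Gamma^\sigma(f,g)-\Gamma^\sigma(f,\Delta^\sigma g)-\Gamma^\sigma(\Delta^\sigma f,g)$. $CD^\sigma(0,\infty)$ means $\Gamma_2^\sigma(f,f)(x)\ge0$ for all $f:V\to\mathbb{K}^d$, $x\in V$. For a $(d\times d)$-matrix $A$ with columns $A^1,\dots,A^d$, $|A|_{2,1}:=\frac1d\sum_{i=1}^d|A^i|$ with $|\cdot|$ the Euclidean (Hermitian) norm. For $\emptyset\ne S\subseteq V$, with $E_S$ the edge set of the induced subgraph of $S$: $\iota^\sigma(S)=\min_{\tau:S\to H}\sum_{\{x,y\}\in E_S}w_{xy}|\sigma_{xy}\tau(y)-\tau(x)|_{2,1}$ (independent of edge orientations), $|E(S,V\setminus S)|=\sum_{x\in S}\sum_{y\notin S}w_{xy}$, $\mu(S)=\sum_{x\in S}\mu(x)$, $\phi^\sigma(S)=\frac{\iota^\sigma(S)+|E(S,V\setminus S)|}{\mu(S)}$. Then $h_k^\sigma=\min_{\{S_i\}_{i=1}^k}\max_{1\le i\le k}\phi^\sigma(S_i)$, the minimum being over all families of $k$ nonempty pairwise disjoint subsets of $V$. *)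

(* Defs.v *)
From HB Require Import structures.
From mathcomp Require Import all_boot all_order all_algebra.
From mathcomp Require Import finmap.
From mathcomp Require Import all_classical all_reals all_analysis.
From mathcomp Require Import complex.

Set Implicit Arguments.
Unset Strict Implicit.
Unset Printing Implicit Defensive.

Import Order.TTheory GRing.Theory Num.Theory.
Local Open Scope ring_scope.

Inductive structure_group := Orthogonal | Unitary.

Definition base_field (R : realType) (H : structure_group) : numFieldType :=
  match H with
  | Orthogonal => R : numFieldType
  | Unitary => R[i] : numFieldType
  end.

Definition of_real (R : realType) (H : structure_group) : R -> base_field R H :=
  match H with
  | Orthogonal => fun a => a
  | Unitary => fun a => (a%:C)%C
  end.

Definition conjs (R : realType) (H : structure_group) :
    base_field R H -> base_field R H :=
  match H with
  | Orthogonal => fun z => z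
  | Unitary => fun z => conjc z
  end.

(* The norm `|z| of z : R[i] lives in R[i]; the modulus is needed in R. *)
Definition modulus (R : realType) (H : structure_group) : base_field R H -> R :=
  match H with
  | Orthogonal => fun z => `|z|
  | Unitary => fun z => complex.Re `|z|
  end.

Record weighted_graph (R : realType) (V : finType) := WeightedGraph {
  adj : rel V;
  weight : V -> V -> R;
  vmeas : V -> R;
  adj_sym : symmetric adj;
  adj_irr : irreflexive adj;
  weight_sym : forall x y, weight x y = weight y x;
  weight_gt0 : forall x y, adj x y -> 0 < weight x y;
  weight_eq0 : forall x y, ~~ adj x y -> weight x y = 0;
  vmeas_gt0 : forall x, 0 < vmeas x
}.

Section ConnectionLaplacian.
Variables (R : realType) (V : finType) (G : weighted_graph R V).
Variables (H : structure_group) (d : nat).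

Local Notation K := (base_field R H).
Local Notation "x ~~> y" := (adj G x y) (at level 70).
Local Notation w := (weight G).
Local Notation mu := (vmeas G).

Definition in_group (A : 'M[K]_d) : Prop :=
  (map_mx (@conjs R H) A)^T *m A = 1%:M.

(* A signature is only constrained, and only ever used, on oriented edges; its
   values on the other pairs of vertices are irrelevant. *)
Definition is_signature (sigma : V -> V -> 'M[K]_d) : Prop :=
  forall x y, x ~~> y ->
    in_group (sigma x y) /\ sigma y x = invmx (sigma x y).

Definition Dnor : R :=
  \big[Num.max/0]_x \big[Num.max/0]_(y | x ~~> y) (mu x / w x y).

Definition laplacian (u : V -> K) (x : V) : K :=
  (of_real H (mu x))^-1 *
    \sum_(y | x ~~> y) of_real H (w x y) * (u y - u x).

Local Notation vsect := {ffun V -> 'cV[K]_d}.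

Definition dot (f g : vsect) (x : V) : K :=
  \sum_(i < d) f x i 0 * conjs (g x i 0).

Variable sigma : V -> V -> 'M[K]_d.

Definition conn_laplacian (f : vsect) : vsect :=
  [ffun x => (of_real H (mu x))^-1 *:
    \sum_(y | x ~~> y) of_real H (w x y) *: (sigma x y *m f y - f x)].

Fact conn_laplacian_is_linear : linear conn_laplacian.
Proof.
move=> a f g; apply/ffunP => x; rewrite !ffunE.
rewrite scalerA mulrC -scalerA -scalerDr; congr (_ *: _).
rewrite scaler_sumr -big_split /=; apply: eq_bigr => y _.
rewrite !ffunE scalerA mulrC -scalerA -scalerDr; congr (_ *: _).
by rewrite mulmxDr -scalemxAr scalerBr opprD addrACA.
Qed.

HB.instance Definition _ :=
  GRing.isLinear.Build K vsect vsect _ conn_laplacian conn_laplacian_is_linear.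

(* The sign convention is Delta^sigma f = - lam f, so this is the eigenspace of
   the endomorphism Delta^sigma at - lam. *)
Definition eigenvalue_space (lam : R) : {vspace vsect} :=
  passmx.leigenspace (linfun conn_laplacian) (- of_real H lam).

Definition eigenvalue_set : set R :=
  [set lam | exists2 f : vsect,
    f != 0 & conn_laplacian f = - of_real H lam *: f]%classic.

(* All the eigenvalues in nondecreasing order, each repeated as many times as
   the dimension over K of its eigenspace. *)
Definition spectrum : seq R :=
  flatten [seq nseq (\dim (eigenvalue_space lam)) lam
          | lam <- sort <=%O (fset_set eigenvalue_set)].

(* Indexed from 1; Delta^sigma is self-adjoint for the mu-weighted inner
   product, so [spectrum] has size #|V| * d and the default value 0 is not
   used for 1 <= j <= #|V| * d. *)
Definition lambda_ (j : nat) : R := nth 0 spectrum j.-1.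

Definition Gamma (f g : vsect) (x : V) : K :=
  2^-1 * (laplacian (dot f g) x - dot f (conn_laplacian g) x
          - dot (conn_laplacian f) g x).

Definition Gamma2 (f g : vsect) (x : V) : K :=
  2^-1 * (laplacian (Gamma f g) x - Gamma f (conn_laplacian g) x
          - Gamma (conn_laplacian f) g x).

(* For K = R[i], 0 <= z means that z is real and nonnegative; Gamma2 f f is
   always real-valued. *)
Definition CD0oo : Prop :=
  forall (f : vsect) (x : V), 0 <= Gamma2 f f x.

Definition norm21 (A : 'M[K]_d) : R :=
  d%:R^-1 * \sum_(i < d) Num.sqrt (\sum_(j < d) modulus (A j i) ^+ 2).

(* Each edge {x, y} of the induced subgraph is counted once, oriented from the
   smaller to the larger vertex in the enumeration of V; the summand does not
   depend on the orientation. *)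
Definition frustration_cost (S : {set V}) (tau : V -> 'M[K]_d) : R :=
  \sum_(x in S) \sum_(y in S | (x ~~> y) && (enum_rank x < enum_rank y)%N)
    w x y * norm21 (sigma x y *m tau y - tau x).

(* The infimum is attained since O(d) and U(d) are compact. *)
Definition frustration (S : {set V}) : R :=
  inf [set frustration_cost S tau |
        tau in [set tau : V -> 'M[K]_d |
                 forall x, x \in S -> in_group (tau x)]]%classic.

Definition boundary (S : {set V}) : R :=
  \sum_(x in S) \sum_(y in ~: S) w x y.

Definition phi (S : {set V}) : R :=
  (frustration S + boundary S) / \sum_(x in S) mu x.

Definition disjoint_family (k : nat) (S : 'I_k -> {set V}) : Prop :=
  (forall i, S i != finset.set0) /\
  (forall i j, i != j -> [disjoint S i & S j]).

(* The infimum ranges over finitely many values, hence is a minimum. For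
   k >= 1 the inner maximum is that of the phi (S i), which are nonnegative. *)
Definition cheeger (k : nat) : R :=
  inf [set \big[Num.max/0]_(i < k) phi (S i) |
        S in [set S : 'I_k -> {set V} | disjoint_family S]]%classic.

End ConnectionLaplacian.

(* Main.v *)
Require Import Defs.
From HB Require Import structures.
From mathcomp Require Import all_boot all_order all_algebra.
From mathcomp Require Import finmap.
From mathcomp Require Import all_classical all_reals all_analysis.
From mathcomp Require Import complex spectral ring lra.

Set Implicit Arguments.
Unset Strict Implicit.
Unset Printing Implicit Defensive.

Import Order.TTheory GRing.Theory Num.Theory.
Local Open Scope ring_scope.

(** The curvature condition says that the heat flow of the connection Laplacian
    flattens sections: a section bounded by 1 has, after time t, a gradient
    bounded by 1 / sqrt (2 t).  Integrating this bound in time shows that the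
    flow moves a section f with |f| <= 1 slowly,
      Re <f - P_t f, f> <= sqrt (2 t) * sum_x mu(x) sqrt (Gamma(f, f)(x)).
    A set S and a frame tau : S -> H give d test sections, the columns of tau
    extended by 0 ([frame_section]).  Their total gradient is at most
    sqrt (2 D) d (iota(S) + |E(S, V \ S)|) ([frame_energy_le]), since the
    difference of a column across an edge is a column of
    sigma_xy tau(y) - tau(x) inside S, a unit vector on the boundary of S,
    and 0 outside.

    For k disjoint sets one gets, after normalisation, k d orthonormal test
    sections.  By Ky Fan's inequality ([ky_fan]) at least one unit of their
    mass lives on eigenvalues >= lambda_{kd}, so that the displacements
    <f - P_t f, f> add up to at least 1 - exp (- t lambda_{kd}).  Comparing
    both estimates at t = 1 / lambda_{kd} bounds sqrt (lambda_{kd}) by a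
    constant times sqrt D times k d h_k, and that constant is at most
    4 sqrt (log 2) <= 4 sqrt (log (2 k d)).

    The exponential of the Laplacian is replaced by n implicit Euler steps,
    the powers of the resolvent (1 - eps Delta)^-1.  One step already satisfies
    the two pointwise inequalities behind the gradient bound ([flow_rgamma] and
    [flow_norm]), and the maximum principle for 1 - eps Delta on functions
    propagates them from step to step ([flow_gradient_decay]).  These
    inequalities give no gradient bound uniform in eps after the first step,
    but its contribution to the displacement is O(eps) and vanishes as n grows
    with eps n = t fixed, while (1 + 1 / n)^-n stays below 5 / 13 along the
    multiples of 12 ([decay_constant]).

    The spectral theorem is needed over the reals and over the complex numbers;
    both cases are proved at once by finding eigenvalues in R[i] and noting
    that those of a Hermitian matrix are real ([hermitian_eigenvector]). *)

(** * The two scalar fields treated uniformly *)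

Section Scalars.
Variables (R : realType) (H : structure_group).
Local Notation K := (base_field R H).
Local Notation "a %:K" := (@of_real R H a) (at level 2, format "a %:K").

Fact of_real_is_zmod_morphism : zmod_morphism (@of_real R H).
Proof. by case: H => a b //; exact: raddfB. Qed.

Fact of_real_is_monoid_morphism : monoid_morphism (@of_real R H).
Proof. by split; case: H => // a b; exact: rmorphM. Qed.

HB.instance Definition _ := GRing.isZmodMorphism.Build R K (@of_real R H)
  of_real_is_zmod_morphism.
HB.instance Definition _ := GRing.isMonoidMorphism.Build R K (@of_real R H)
  of_real_is_monoid_morphism.

Fact conjs_is_zmod_morphism : zmod_morphism (@conjs R H).
Proof. by case: H => a b //; exact: raddfB. Qed.

Fact conjs_is_monoid_morphism : monoid_morphism (@conjs R H).
Proof.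
by split; case: H => //; [exact: (conjc1 R) | exact: (rmorphM (@conjc R))].
Qed.

HB.instance Definition _ := GRing.isZmodMorphism.Build K K (@conjs R H)
  conjs_is_zmod_morphism.
HB.instance Definition _ := GRing.isMonoidMorphism.Build K K (@conjs R H)
  conjs_is_monoid_morphism.

Lemma conjsK : involutive (@conjs R H).
Proof. by case: H => z //=; rewrite conjcK. Qed.

Lemma conjs_of_real a : conjs (a%:K) = a%:K.
Proof. by case: H => //; exact: (conjc_real a). Qed.

Definition real_part : K -> R :=
  match H with
  | Orthogonal => fun z => z
  | Unitary => fun z => complex.Re z
  end.

Fact real_part_is_zmod_morphism : zmod_morphism real_part.
Proof. by rewrite /real_part; case: H => // -[a b] [c e]. Qed.

HB.instance Definition _ := GRing.isZmodMorphism.Build K R real_part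
  real_part_is_zmod_morphism.

Lemma real_partZ a z : real_part (a%:K * z) = a * real_part z.
Proof.
rewrite /real_part; case: H z => //= -[b c] /=.
by rewrite mul0r subr0.
Qed.

Lemma real_part_of_real a : real_part a%:K = a.
Proof. by rewrite /real_part; case: H. Qed.

Lemma real_part_conjs z : real_part (conjs z) = real_part z.
Proof. by rewrite /real_part; case: H z => //= -[b c]. Qed.

Lemma real_part_ge0 z : 0 <= z -> 0 <= real_part z.
Proof.
by rewrite /real_part; case: H z => //= -[b c]; rewrite lecE /= => /andP[].
Qed.

Lemma mulr_conjs (z : K) : z * conjs z = (modulus z ^+ 2)%:K.
Proof.
case: H z => /= [z|[a b]] /=; first by rewrite -normrX ger0_norm ?sqr_ge0.
rewrite sqr_sqrtr ?addr_ge0 ?sqr_ge0//.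
apply/eqP; rewrite eq_complex /=; apply/andP; split; apply/eqP; ring.
Qed.

(** The identity z * conj z = |z|^2 reduces this to the absence of
    zero divisors. *)
Lemma modulus_eq0 (z : K) : (modulus z == 0) = (z == 0).
Proof.
have := mulf_eq0 z (conjs z).
by rewrite mulr_conjs !fmorph_eq0 sqrf_eq0 orbb.
Qed.

(** Both scalar fields embed in the algebraically closed field R[i], where
    eigenvalues exist. *)
Definition to_complex : K -> R[i] :=
  match H with
  | Orthogonal => fun z => z%:C%C
  | Unitary => fun z => z
  end.

Fact to_complex_is_zmod_morphism : zmod_morphism to_complex.
Proof. by rewrite /to_complex; case: H => a b //; exact: raddfB. Qed.

Fact to_complex_is_monoid_morphism : monoid_morphism to_complex.
Proof. by rewrite /to_complex; split; case: H => // a b; exact: rmorphM. Qed.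

HB.instance Definition _ := GRing.isZmodMorphism.Build K R[i] to_complex
  to_complex_is_zmod_morphism.
HB.instance Definition _ := GRing.isMonoidMorphism.Build K R[i] to_complex
  to_complex_is_monoid_morphism.

Lemma to_complex_conjs z : to_complex (conjs z) = conjc (to_complex z).
Proof. by rewrite /to_complex; case: H z => // z; exact: esym (conjc_real z). Qed.

Lemma to_complex_of_real a : to_complex a%:K = (a%:C)%C.
Proof. by rewrite /to_complex; case: H. Qed.

End Scalars.

(** * Spectral theorem for Hermitian matrices over both fields *)

Section Spectral.
Variables (R : realType) (H : structure_group).
Local Notation K := (base_field R H).
Local Notation "a %:K" := (@of_real R H a) (at level 2, format "a %:K").

Definition adjmx m n (A : 'M[K]_(m, n)) : 'M[K]_(n, m) :=
  (map_mx (@conjs R H) A)^T.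

Lemma adjmxK m n (A : 'M[K]_(m, n)) : adjmx (adjmx A) = A.
Proof. by apply/matrixP => i j; rewrite !mxE conjsK. Qed.

Lemma adjmxM m n p (A : 'M[K]_(m, n)) (B : 'M[K]_(n, p)) :
  adjmx (A *m B) = adjmx B *m adjmx A.
Proof. by rewrite /adjmx map_mxM trmx_mul. Qed.

Lemma adjmxZ m n (a : K) (A : 'M[K]_(m, n)) :
  adjmx (a *: A) = conjs a *: adjmx A.
Proof. by rewrite /adjmx map_mxZ linearZ. Qed.

Lemma row_adjmx n (u : 'rV[K]_n) :
  u *m adjmx u = ((\sum_j modulus (u 0 j) ^+ 2)%:K)%:M.
Proof.
apply/matrixP => i j; rewrite !ord1 !mxE mulr1n rmorph_sum /=.
by apply: eq_bigr => q _; rewrite !mxE mulr_conjs.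
Qed.

Lemma row_adjmx_gt0 n (u : 'rV[K]_n) : u != 0 -> 0 < \sum_j modulus (u 0 j) ^+ 2.
Proof.
move=> u0; rewrite lt_def sumr_ge0 ?andbT => [|j _]; last exact: sqr_ge0.
apply: contra u0; rewrite psumr_eq0 => [/allP h|j _]; last exact: sqr_ge0.
apply/eqP/rowP => j; rewrite mxE; apply/eqP; rewrite -modulus_eq0 -sqrf_eq0.
exact: h (mem_index_enum j).
Qed.

(** The restriction of T to the row space of U has an eigenvalue in R[i].  An
    eigenvector w satisfies c w w^* = w T w^* = conj c w w^*, so c is real; it
    is therefore an eigenvalue of the restriction over the original field too. *)
Lemma hermitian_eigenvector n (T U : 'M[K]_n) :
    adjmx T = T -> stablemx U T -> U != 0 ->
  exists (v : 'rV[K]_n) (a : R),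
    [/\ v != 0, (v <= U)%MS & v *m T = a%:K *: v].
Proof.
move=> hT sU U0; set B := row_base U.
have rU : (0 < \rank U)%N by rewrite lt0n mxrank_eq0.
have fB : row_free B by exact: row_base_free.
have BT : B *m T = (B *m T *m pinvmx B) *m B.
  rewrite mulmxKpV // (eqmxMr T (eq_row_base U)).
  by rewrite (submx_trans sU)// eq_row_base.
(* X is the matrix of T on the row space of U, in the basis B. *)
set X := B *m T *m pinvmx B in BT.
have [c /eigenvalueP[v vX v0]] := eigenvalue_closed (map_mx (@to_complex R H) X) rU.
set iT := map_mx (@to_complex R H) T; set iB := map_mx (@to_complex R H) B.
have wT : (v *m iB) *m iT = c *: (v *m iB).
  by rewrite -mulmxA -map_mxM BT map_mxM mulmxA vX -scalemxAl.
have w0 : v *m iB != 0.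
  have fiB : row_free iB by rewrite row_free_map.
  apply: contraNneq v0 => e; apply/eqP.
  by apply: (row_free_inj fiB); rewrite e mul0mx.
set w := v *m iB in wT w0.
pose cw := (map_mx (@conjc R) w)^T.
have hiT : (map_mx (@conjc R) iT)^T = iT.
  by apply/matrixP => i j; rewrite /iT -[in RHS]hT !mxE to_complex_conjs.
have creal : c = (complex.Re c)%:C%C.
  have e1 : w *m iT *m cw = c *: (w *m cw) by rewrite wT -scalemxAl.
  have e2 : w *m iT *m cw = (conjc c) *: (w *m cw).
    rewrite -mulmxA -{1}hiT /cw -trmx_mul -map_mxM wT.
    by rewrite map_mxZ linearZ /= -scalemxAr.
  have wc0 : (w *m cw) 0 0 != 0.
    apply: contra w0; rewrite mxE psumr_eq0 => [/allP h|j _]; last first.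
      by rewrite !mxE (@mulr_conjs R Unitary) ler0c sqr_ge0.
    apply/eqP/rowP => j; rewrite [RHS]mxE.
    have := h j (mem_index_enum j); rewrite !mxE mulf_eq0 conjc_eq0 orbb.
    by move/eqP.
  have : c = conjc c.
    apply: (mulIf wc0); move: e2; rewrite e1 => /matrixP/(_ 0 0).
    by rewrite !mxE.
  case: (c) => x y [] /eqP; rewrite -addr_eq0 -mulr2n mulrn_eq0 /= => /eqP ->.
  by [].
have : eigenvalue X (complex.Re c)%:K.
  rewrite -(eigenvalue_map (@to_complex R H)) /= to_complex_of_real -creal.
  by apply/eigenvalueP; exists v.
move=> /eigenvalueP[u uX u0]; exists (u *m B), (complex.Re c); split.
- apply: contraNneq u0 => e; apply/eqP.
  by apply: (row_free_inj fB); rewrite e mul0mx.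
- by rewrite (submx_trans (submxMl _ _))// eq_row_base.
- by rewrite -mulmxA BT mulmxA uX -scalemxAl.
Qed.

Lemma adjmx_col m1 m2 n (A : 'M[K]_(m1, n)) (B : 'M[K]_(m2, n)) :
  adjmx (col_mx A B) = row_mx (adjmx A) (adjmx B).
Proof. by rewrite /adjmx map_col_mx tr_col_mx. Qed.

(** Induction on j: the orthogonal complement of j eigenvectors is stable under
    T because T is Hermitian, and it is nonzero as long as j < n. *)
Lemma hermitian_partial_eigenbasis n (T : 'M[K]_n) j :
    adjmx T = T -> (j <= n)%N ->
  exists (P : 'M[K]_(j, n)) (l : 'I_j -> R),
    P *m adjmx P = 1%:M /\ forall i, row i P *m T = (l i)%:K *: row i P.
Proof.
move=> hT; elim: j => [_|j IH jn]; last rewrite -[j.+1]/(1 + j)%N.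
  exists 0, (fun=> 0); split; first by apply/matrixP => -[].
  by case.
have [P [l [PP PT]]] := IH (ltnW jn).
pose D := diag_mx (\row_i (l i)%:K).
have DT : P *m T = D *m P.
  by apply/row_matrixP => i; rewrite !row_mul PT row_diag_mx mxE -scalemxAl -rowE.
set U := kermx (adjmx P).
have sU : stablemx U T.
  apply/sub_kermxP; have -> : U *m T *m adjmx P = U *m adjmx P *m adjmx D.
    by rewrite -!mulmxA -adjmxM -DT adjmxM hT.
  by rewrite mulmx_ker mul0mx.
have U0 : U != 0.
  by rewrite -mxrank_eq0 mxrank_ker -lt0n subn_gt0 (leq_ltn_trans (rank_leq_col _)).
have [v [a [v0 vU vT]]] := hermitian_eigenvector hT sU U0.
have s0 := row_adjmx_gt0 v0; set s := \sum_j0 _ in s0.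
pose c := (Num.sqrt s)^-1.
have vP : v *m adjmx P = 0 by apply/sub_kermxP.
exists (col_mx (c%:K *: v) P : 'M[K]_(1 + j, n)),
  (fun i : 'I_(1 + j) => match fintype.split i with inl _ => a | inr i => l i end).
split.
  rewrite adjmx_col mul_col_row PP adjmxZ -!scalemxAl -!scalemxAr vP.
  have -> : P *m adjmx v = 0.
    by rewrite -[P *m _]adjmxK adjmxM adjmxK vP /adjmx map_mx0 trmx0.
  rewrite !scaler0 row_adjmx -/s scalerA conjs_of_real -!rmorphM scale_scalar_mx.
  rewrite -rmorphM /c -invfM -expr2 sqr_sqrtr ?ltW// mulVf ?gt_eqF// rmorph1.
  by rewrite -scalar_mx_block.
move=> i; case: (splitP i) => q iq.
  have -> : i = lshift j q by apply: val_inj.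
  rewrite rowKu [q]ord1 row_id -scalemxAl vT !scalerA.
  by rewrite mulrC.
have -> : i = rshift 1 q by apply: val_inj.
by rewrite rowKd PT.
Qed.

Theorem hermitian_eigenbasis n (T : 'M[K]_n) : adjmx T = T ->
  exists (P : 'M[K]_n) (l : 'I_n -> R),
    P *m adjmx P = 1%:M /\ forall i, row i P *m T = (l i)%:K *: row i P.
Proof. by move=> hT; exact: hermitian_partial_eigenbasis hT (leqnn n). Qed.

End Spectral.

(** * The Hermitian product of the fibre and the structure group *)

Section HermitianDot.
Variables (R : realType) (H : structure_group) (d : nat).
Local Notation K := (base_field R H).
Local Notation "a %:K" := (@of_real R H a) (at level 2, format "a %:K").
Implicit Types u v : 'cV[K]_d.

Definition hdot u v : K := \sum_(i < d) u i 0 * conjs (v i 0).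
Definition rdot u v : R := real_part (hdot u v).

Lemma hdotE u v : hdot u v = (u^T *m map_mx (@conjs R H) v) 0 0.
Proof. by rewrite mxE; apply: eq_bigr => i _; rewrite !mxE. Qed.

Lemma hdot_conj u v : hdot v u = conjs (hdot u v).
Proof.
rewrite rmorph_sum; apply: eq_bigr => i _.
by rewrite rmorphM /= conjsK mulrC.
Qed.

Lemma hdotDl u1 u2 v : hdot (u1 + u2) v = hdot u1 v + hdot u2 v.
Proof. by rewrite -big_split; apply: eq_bigr => i _; rewrite mxE mulrDl. Qed.

Lemma hdotZl a u v : hdot (a *: u) v = a * hdot u v.
Proof. by rewrite mulr_sumr; apply: eq_bigr => i _; rewrite mxE mulrA. Qed.

Lemma hdotDr u v1 v2 : hdot u (v1 + v2) = hdot u v1 + hdot u v2.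
Proof. by rewrite hdot_conj hdotDl rmorphD /= -!hdot_conj. Qed.

Lemma hdotZr a u v : hdot u (a *: v) = conjs a * hdot u v.
Proof. by rewrite hdot_conj hdotZl rmorphM /= -hdot_conj. Qed.

Lemma hdotBl u1 u2 v : hdot (u1 - u2) v = hdot u1 v - hdot u2 v.
Proof. by rewrite hdotDl -scaleN1r hdotZl mulN1r. Qed.

Lemma hdotBr u v1 v2 : hdot u (v1 - v2) = hdot u v1 - hdot u v2.
Proof. by rewrite hdotDr -scaleN1r hdotZr rmorphN1 mulN1r. Qed.

Lemma hdot0r u : hdot u 0 = 0.
Proof. by rewrite -(subrr 0) hdotBr subrr. Qed.

Lemma rdotC u v : rdot u v = rdot v u.
Proof. by rewrite /rdot hdot_conj real_part_conjs. Qed.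

Lemma rdotDl u1 u2 v : rdot (u1 + u2) v = rdot u1 v + rdot u2 v.
Proof. by rewrite /rdot hdotDl raddfD. Qed.

Lemma rdotZl (a : R) u v : rdot (a%:K *: u) v = a * rdot u v.
Proof. by rewrite /rdot hdotZl real_partZ. Qed.

Lemma rdotBl u1 u2 v : rdot (u1 - u2) v = rdot u1 v - rdot u2 v.
Proof. by rewrite /rdot hdotBl raddfB. Qed.

Lemma rdotDr u v1 v2 : rdot u (v1 + v2) = rdot u v1 + rdot u v2.
Proof. by rewrite rdotC rdotDl !(rdotC u). Qed.

Lemma rdotZr (a : R) u v : rdot u (a%:K *: v) = a * rdot u v.
Proof. by rewrite rdotC rdotZl rdotC. Qed.

Lemma rdotBr u v1 v2 : rdot u (v1 - v2) = rdot u v1 - rdot u v2.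
Proof. by rewrite rdotC rdotBl !(rdotC u). Qed.

Lemma rdot0 u : rdot 0 u = 0.
Proof.
by rewrite -(scale0r (0 : 'cV[K]_d)) -(rmorph0 (@of_real R H)) rdotZl mul0r.
Qed.

Lemma rdot_modulus u : rdot u u = \sum_(i < d) modulus (u i 0) ^+ 2.
Proof.
rewrite /rdot /hdot raddf_sum; apply: eq_bigr => i _.
by rewrite mulr_conjs /= real_part_of_real.
Qed.

Lemma rdot_ge0 u : 0 <= rdot u u.
Proof. by rewrite rdot_modulus sumr_ge0 // => i _; exact: sqr_ge0. Qed.

(** The group is given by A^* A = 1 with the conjugation on the left factor;
    conjugating this identity gives the form A^T conj A = 1 that appears in the
    Hermitian product. *)
Lemma hdot_isometry (A : 'M[K]_d) u v : in_group A ->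
  hdot (A *m u) (A *m v) = hdot u v.
Proof.
rewrite /in_group => hA; rewrite !hdotE trmx_mul map_mxM !mulmxA.
suff e : A^T *m map_mx (@conjs R H) A = 1%:M by rewrite -(mulmxA u^T) e mulmx1.
have /(congr1 (map_mx (@conjs R H))) := hA; rewrite map_mxM map_mx1 => <-.
by congr (_ *m _); apply/matrixP => i j; rewrite !mxE /= conjsK.
Qed.

Lemma hdot_signature_adjoint (A : 'M[K]_d) u v : in_group A ->
  hdot (A *m u) v = hdot u (invmx A *m v).
Proof.
move=> hA; rewrite -[RHS](hdot_isometry _ _ hA) mulmxA mulmxV ?mul1mx//.
by have [] := mulmx1_unit hA.
Qed.

Lemma in_group_hdot_col (A : 'M[K]_d) i j : in_group A ->
  hdot (col i A) (col j A) = (i == j)%:R.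
Proof.
move=> hA; have -> : col i A = A *m delta_mx i 0 by rewrite colE.
rewrite colE hdot_isometry // /hdot (bigD1 i) //= big1 ?addr0 => [|q qi].
  by rewrite !mxE !eqxx !andbT mul1r rmorph_nat.
by rewrite !mxE (negPf qi) mul0r.
Qed.

End HermitianDot.

(** * Calculus on sections: Green's formula and the carre du champ *)

Section Calculus.
Variables (R : realType) (V : finType) (G : weighted_graph R V).
Variables (H : structure_group) (d : nat).
Local Notation K := (base_field R H).
Local Notation "a %:K" := (@of_real R H a) (at level 2, format "a %:K").
Local Notation "x ~~> y" := (adj G x y) (at level 70).
Local Notation w := (weight G).
Local Notation mu := (vmeas G).
Local Notation vsect := {ffun V -> 'cV[K]_d}.

Variable sigma : V -> V -> 'M[K]_d.
Implicit Types f g h : vsect.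
Hypothesis sigmaP : is_signature G sigma.
Local Notation Delta := (conn_laplacian G sigma).

Definition real_laplacian (u : V -> R) (x : V) : R :=
  (mu x)^-1 * \sum_(y | x ~~> y) w x y * (u y - u x).

Lemma real_laplacianD u v (c : R) x :
  real_laplacian (fun y => u y + c * v y) x =
  real_laplacian u x + c * real_laplacian v x.
Proof.
rewrite /real_laplacian mulrCA -mulrDr; congr (_ * _).
by rewrite mulr_sumr -big_split; apply: eq_bigr => y _ /=; ring.
Qed.

Lemma real_part_laplacian (u : V -> K) x :
  real_part (laplacian G u x) = real_laplacian (fun y => real_part (u y)) x.
Proof.
rewrite /laplacian -fmorphV real_partZ raddf_sum; congr (_ * _).
by apply: eq_bigr => y _; rewrite /= real_partZ raddfB.
Qed.

(** At a maximum point m of u the Laplacian is nonpositive, hence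
    u m <= u m - eps * L u m <= M. *)
Lemma resolvent_maximum_principle (u : V -> R) (eps M : R) : 0 <= eps ->
  (forall x, u x - eps * real_laplacian u x <= M) -> forall x, u x <= M.
Proof.
move=> eps0 h x; have [m _ mP] := arg_maxP u (erefl : xpredT x).
apply: le_trans (mP x isT) _; apply: le_trans (h m).
rewrite lerDl oppr_ge0; apply: mulr_ge0_le0 => //; apply: mulr_ge0_le0.
  by rewrite invr_ge0 ltW ?vmeas_gt0.
apply: sumr_le0 => y my; apply: mulr_ge0_le0; last by rewrite subr_le0; exact: mP.
by rewrite ltW ?weight_gt0.
Qed.

(** The summand w x y * (u y - u x) is antisymmetric in x and y. *)
Lemma sum_real_laplacian u : \sum_x mu x * real_laplacian u x = 0.
Proof.
pose a x y := if x ~~> y then w x y * (u y - u x) else 0.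
have e : \sum_x mu x * real_laplacian u x = \sum_x \sum_y a x y.
  apply: eq_bigr => x _; rewrite mulrA mulfV ?mul1r ?gt_eqF ?vmeas_gt0//.
  by rewrite big_mkcond.
have : \sum_x \sum_y a x y = - \sum_x \sum_y a x y.
  rewrite -sumrN exchange_big /=; apply: eq_bigr => x _; rewrite -sumrN.
  apply: eq_bigr => y _; rewrite /a adj_sym weight_sym; case: ifP => _; ring.
rewrite e; lra.
Qed.

Definition edge_diff (f : vsect) x y : 'cV[K]_d := sigma x y *m f y - f x.

Lemma conn_laplacianE f x :
  Delta f x = (mu x)^-1%:K *: \sum_(y | x ~~> y) (w x y)%:K *: edge_diff f x y.
Proof. by rewrite ffunE fmorphV. Qed.

Lemma edge_diff_lin (a : R) f g x y :
  edge_diff (f + a%:K *: g) x y = edge_diff f x y + a%:K *: edge_diff g x y.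
Proof.
by rewrite /edge_diff !ffunE mulmxDr -scalemxAr scalerBr opprD addrACA.
Qed.

(** The weight mu is the one that makes the connection Laplacian self-adjoint. *)
Definition inner (f g : vsect) : K := \sum_x (mu x)%:K * dot f g x.

Lemma inner_mul f g x : (mu x)%:K * dot (Delta f) g x =
  \sum_(y | x ~~> y) (w x y)%:K * hdot (edge_diff f x y) (g x).
Proof.
rewrite -[dot _ _ _]/(hdot _ _) conn_laplacianE hdotZl mulrA -rmorphM /=.
rewrite mulfV ?gt_eqF ?vmeas_gt0// rmorph1 mul1r.
rewrite (big_morph (fun u => hdot u (g x)) (fun u v => hdotDl u v (g x)) (_ : _ = 0)).
  by apply: eq_bigr => y _; rewrite hdotZl.
by rewrite /hdot big1 // => i _; rewrite mxE mul0r.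
Qed.

(** Parallel transport along (x, y) is adjoint to transport along (y, x),
    because sigma y x is the inverse of the isometry sigma x y. *)
Lemma conn_laplacian_selfadjoint f g : inner (Delta f) g = inner f (Delta g).
Proof.
have e h k : inner (Delta h) k = \sum_x \sum_y
   if x ~~> y then (w x y)%:K * hdot (edge_diff h x y) (k x) else 0.
  by apply: eq_bigr => x _; rewrite inner_mul big_mkcond.
have -> : inner f (Delta g) = conjs (inner (Delta g) f).
  rewrite rmorph_sum; apply: eq_bigr => x _ /=.
  by rewrite rmorphM /= conjs_of_real -hdot_conj.
have split h k : \sum_x \sum_y
   (if x ~~> y then (w x y)%:K * hdot (edge_diff h x y) (k x) else 0) =
   \sum_x \sum_y (if x ~~> y then (w x y)%:K * hdot (sigma x y *m h y) (k x) else 0)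
   - \sum_x \sum_y (if x ~~> y then (w x y)%:K * hdot (h x) (k x) else 0).
  rewrite -sumrB; apply: eq_bigr => x _; rewrite -sumrB; apply: eq_bigr => y _.
  by case: ifP; rewrite ?subr0 // hdotBl mulrBr.
rewrite !e !split rmorphB; congr (_ - _).
  rewrite rmorph_sum exchange_big; apply: eq_bigr => x _.
  rewrite rmorph_sum; apply: eq_bigr => y _ /=.
  rewrite adj_sym weight_sym; case: ifP => xy; last by rewrite rmorph0.
  rewrite rmorphM /= conjs_of_real -hdot_conj; congr (_ * _).
  have xy' : y ~~> x by rewrite adj_sym.
  rewrite hdot_signature_adjoint; last exact: (sigmaP xy').1.
  by rewrite -(sigmaP xy').2.
rewrite rmorph_sum; apply: eq_bigr => x _.
rewrite rmorph_sum; apply: eq_bigr => y _ /=.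
case: ifP => xy; last by rewrite rmorph0.
by rewrite rmorphM /= conjs_of_real -hdot_conj.
Qed.

(** The curvature condition, Green's formula and the Cauchy-Schwarz inequality
    are used at the level of real parts. *)
Definition rgamma (f g : vsect) (x : V) : R := real_part (Gamma G sigma f g x).

Lemma real_part_half (z : K) : real_part (2^-1 * z) = 2^-1 * real_part z.
Proof.
have -> : (2^-1 : K) = (2^-1)%:K by rewrite fmorphV rmorph_nat.
exact: real_partZ.
Qed.

Lemma rgamma_bakry f g x : rgamma f g x =
  2^-1 * (real_laplacian (fun y => rdot (f y) (g y)) x
          - rdot (f x) (Delta g x) - rdot (Delta f x) (g x)).
Proof.
by rewrite /rgamma real_part_half 2!raddfB /= real_part_laplacian.
Qed.

Lemma rdot_conn_laplacian f g x : rdot (Delta f x) (g x) =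
  (mu x)^-1 * \sum_(y | x ~~> y) w x y * rdot (edge_diff f x y) (g x).
Proof.
have := congr1 (@real_part R H) (inner_mul f g x).
rewrite real_partZ [X in _ = X]raddf_sum /= => h.
rewrite -[LHS](mulKf (lt0r_neq0 (vmeas_gt0 G x))) [mu x * _]h.
by congr (_ * _); apply: eq_bigr => y _; rewrite real_partZ.
Qed.

(** The transports are isometries, so the terms |f y|^2 of the Laplacian of
    |f|^2 combine with the cross terms into squared edge differences. *)
Lemma rgammaE f g x : rgamma f g x =
  (2 * mu x)^-1 * \sum_(y | x ~~> y) w x y * rdot (edge_diff f x y) (edge_diff g x y).
Proof.
rewrite rgamma_bakry [rdot (f x) _]rdotC !rdot_conn_laplacian /real_laplacian.
rewrite -!mulrBr mulrA -invfM; congr (_ * _); rewrite -!sumrB.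
apply: eq_bigr => y xy; rewrite -!mulrBr; congr (_ * _).
rewrite /edge_diff !rdotBl !rdotBr.
have -> : rdot (sigma x y *m f y) (sigma x y *m g y) = rdot (f y) (g y).
  by rewrite /rdot (hdot_isometry _ _ (sigmaP xy).1).
by rewrite (rdotC (sigma x y *m g y)) (rdotC (g x) (f x)); ring.
Qed.

Lemma rgammaC f g x : rgamma f g x = rgamma g f x.
Proof. by rewrite !rgammaE; congr (_ * _); apply: eq_bigr => y _; rewrite rdotC. Qed.

Lemma rgamma_lin (a : R) f g h x :
  rgamma (f + a%:K *: g) h x = rgamma f h x + a * rgamma g h x.
Proof.
rewrite !rgammaE mulrCA -mulrDr; congr (_ * _).
rewrite mulr_sumr -big_split; apply: eq_bigr => y _ /=.
by rewrite edge_diff_lin rdotDl rdotZl; ring.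
Qed.

Lemma rgamma_ge0 f x : 0 <= rgamma f f x.
Proof.
rewrite rgammaE; apply: mulr_ge0.
  by rewrite invr_ge0 mulr_ge0 // ltW // vmeas_gt0.
by apply: sumr_ge0 => y xy; rewrite mulr_ge0 ?rdot_ge0 ?ltW ?weight_gt0.
Qed.

Lemma rgamma_quad (a : R) f g x :
  rgamma (f + a%:K *: g) (f + a%:K *: g) x =
  rgamma f f x + 2 * a * rgamma f g x + a ^+ 2 * rgamma g g x.
Proof.
rewrite rgamma_lin !(rgammaC _ (f + _)) !rgamma_lin (rgammaC g f); ring.
Qed.

(** The discriminant of the nonnegative quadratic polynomial
    s |-> Gamma (f + s g, f + s g) is nonpositive. *)
Lemma rgamma_cauchy f g x :
  rgamma f g x <= Num.sqrt (rgamma f f x) * Num.sqrt (rgamma g g x).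
Proof.
rewrite -sqrtrM ?rgamma_ge0//; apply: le_trans (ler_norm _) _.
rewrite -sqrtr_sqr ler_wsqrtr //.
set a := rgamma f f x; set b := rgamma f g x; set c := rgamma g g x.
have a0 : 0 <= a by exact: rgamma_ge0.
have c0 : 0 <= c by exact: rgamma_ge0.
have q s : 0 <= a + 2 * s * b + s ^+ 2 * c by rewrite -rgamma_quad rgamma_ge0.
have [cp|] := ltP 0 c.
  (* The minimum of the polynomial is attained at s = - b / c. *)
  have := q (- b / c); rewrite -(pmulr_rge0 _ cp).
  suff -> : c * (a + 2 * (- b / c) * b + (- b / c) ^+ 2 * c) = a * c - b ^+ 2 by lra.
  by field; rewrite gt_eqF.
move=> c1; have {c1 c0}c0 : c = 0 by apply/eqP; rewrite eq_le c1.
rewrite c0 mulr0; have [->|b0] := eqVneq b 0; first by rewrite expr0n.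
(* When c = 0 the polynomial is affine, and unless b = 0 it takes the value -1
   at this point. *)
have := q (- (a + 1) / (2 * b)); rewrite c0.
suff -> : 2 * (- (a + 1) / (2 * b)) * b = - (a + 1) by lra.
by field.
Qed.

Lemma real_part_inner f g :
  real_part (inner f g) = \sum_x mu x * rdot (f x) (g x).
Proof. by rewrite raddf_sum; apply: eq_bigr => x _; rewrite /= real_partZ. Qed.

Lemma green f g : \sum_x mu x * rgamma f g x = - real_part (inner (Delta f) g).
Proof.
have s : \sum_x mu x * rdot (f x) (Delta g x) = \sum_x mu x * rdot (Delta f x) (g x).
  by rewrite -!real_part_inner conn_laplacian_selfadjoint.
under eq_bigr do rewrite rgamma_bakry mulrCA !mulrBr.
rewrite !sumrB -!mulr_sumr sum_real_laplacian s real_part_inner; lra.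
Qed.

End Calculus.

(** * Gradient estimates for the implicit Euler heat flow *)

Section Flow.
Variables (R : realType) (V : finType) (G : weighted_graph R V).
Variables (H : structure_group) (d : nat).
Local Notation K := (base_field R H).
Local Notation "a %:K" := (@of_real R H a) (at level 2, format "a %:K").
Local Notation mu := (vmeas G).
Local Notation vsect := {ffun V -> 'cV[K]_d}.

Variable sigma : V -> V -> 'M[K]_d.
Hypothesis sigmaP : is_signature G sigma.
Hypothesis cd : CD0oo G sigma.
Implicit Types f h : vsect.
Local Notation Delta := (conn_laplacian G sigma).
Local Notation L := (real_laplacian G).
Local Notation rgam := (rgamma G sigma).

Lemma curvature_inequality f x : 2 * rgam f (Delta f) x <= L (rgam f f) x.
Proof.
have := real_part_ge0 (cd f x).
rewrite /Gamma2 real_part_half 2!raddfB /= real_part_laplacian.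
rewrite -![real_part _]/(rgam _ _ x) [rgam (Delta f) _ x]rgammaC //.
rewrite -[real_laplacian _ _ _]/(L (rgam f f) x); lra.
Qed.

Variables (eps : R) (g : nat -> vsect).
Hypothesis eps_gt0 : 0 < eps.
Hypothesis flow : forall j, g j = g j.+1 - eps%:K *: Delta (g j.+1).

Lemma flowE j : g j = g j.+1 + (- eps)%:K *: Delta (g j.+1).
Proof. by rewrite flow rmorphN scaleNr. Qed.

(** With g the new section, the old one is g - eps Delta g.  Expanding Gamma of
    it, the linear term is bounded below by - eps * L (Gamma g) thanks to the
    curvature condition, and the quadratic term is nonnegative. *)
Lemma flow_rgamma j x :
  rgam (g j.+1) (g j.+1) x - eps * L (rgam (g j.+1) (g j.+1)) x
  <= rgam (g j) (g j) x.
Proof.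
rewrite [in leRHS]flowE rgamma_quad //.
have h0 := rgamma_ge0 sigmaP (Delta (g j.+1)) x.
have := curvature_inequality (g j.+1) x.
rewrite -(ler_pM2l eps_gt0) => h.
have : 0 <= (- eps) ^+ 2 * rgam (Delta (g j.+1)) (Delta (g j.+1)) x.
  by rewrite mulr_ge0 ?sqr_ge0.
lra.
Qed.

(** Same expansion for |g - eps Delta g|^2, with the definition of Gamma in
    place of the curvature condition. *)
Lemma flow_norm j x :
  rdot (g j.+1 x) (g j.+1 x) - eps * L (fun y => rdot (g j.+1 y) (g j.+1 y)) x
    + 2 * eps * rgam (g j.+1) (g j.+1) x
  <= rdot (g j x) (g j x).
Proof.
set u := g j.+1 x; set v := Delta (g j.+1) x.
have -> : g j x = u + (- eps)%:K *: v.
  by rewrite [in LHS]flowE ffunE [X in _ + X = _]ffunE.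
rewrite rdotDl !rdotDr !rdotZl !rdotZr (rdotC v u) rgamma_bakry -/u -/v (rdotC v u).
have : 0 <= (eps ^+ 2) * rdot v v by rewrite mulr_ge0 ?sqr_ge0 ?rdot_ge0.
lra.
Qed.

(** Crude bound by the initial gradient; it serves for the first Euler step, to
    which the decay estimate does not apply. *)
Lemma flow_gradient_bounded n x :
  rgam (g n) (g n) x <= \sum_y rgam (g 0%N) (g 0%N) y.
Proof.
elim: n x => [|n IH] x; last first.
  apply: (resolvent_maximum_principle (ltW eps_gt0)) x => x.
  exact: le_trans (flow_rgamma n x) (IH x).
rewrite (bigD1 x) //= lerDl sumr_ge0 // => y _; exact: rgamma_ge0.
Qed.

Hypothesis g0_le1 : forall x, rdot (g 0%N x) (g 0%N x) <= 1.

(** Discrete reverse Poincare inequality.  The combination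
    u_n = |g_n|^2 + 2 eps n Gamma (g_{n+1}) satisfies u_{n+1} - eps L u_{n+1} <= u_n:
    one term 2 eps Gamma (g_{n+1}) released by flow_norm pays for the increase
    of the factor n.  The index shift on Gamma is what makes flow_rgamma
    applicable, and the maximum principle then gives u_n <= 1. *)
Lemma flow_gradient_decay n x :
  2 * eps * n%:R * rgam (g n.+1) (g n.+1) x <= 1.
Proof.
suff h : forall n x,
    rdot (g n x) (g n x) + 2 * eps * n%:R * rgam (g n.+1) (g n.+1) x <= 1.
  by apply: le_trans (h n x); rewrite lerDr rdot_ge0.
move=> {n x} n; elim: n => [x|n IH].
  by rewrite mulr0 mul0r addr0.
apply: (resolvent_maximum_principle (ltW eps_gt0)) => x.
apply: le_trans (IH x); rewrite real_laplacianD.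
have h1 := flow_norm n x; have := flow_rgamma n.+1 x.
have c0 : 0 <= 2 * eps * n.+1%:R by rewrite !mulr_ge0 // ltW.
move/(ler_wpM2l c0); rewrite -natr1; lra.
Qed.

Lemma flow_step f n : real_part (inner G (g n) f) - real_part (inner G (g n.+1) f)
  = eps * \sum_x mu x * rgam (g n.+1) f x.
Proof.
rewrite green // !real_part_inner mulrN mulr_sumr -sumrB -sumrN.
apply: eq_bigr => x _; set v := Delta (g n.+1) x.
have -> : g n x = g n.+1 x + (- eps)%:K *: v.
  by rewrite [in LHS]flowE ffunE [X in _ + X = _]ffunE.
by rewrite rdotDl rdotZl; ring.
Qed.

(** Green's formula and Cauchy-Schwarz bound the displacement of one step by
    eps times the sup of the current gradient times the initial energy.  After
    n + 1 steps the next one contributes at most eps / sqrt (2 eps (n + 1)),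
    which is at most sqrt (2 eps (n + 1)) - sqrt (2 eps n), so the sum telescopes. *)
Lemma flow_displacement n :
  real_part (inner G (g 0%N) (g 0%N)) - real_part (inner G (g n.+1) (g 0%N)) <=
  (eps * Num.sqrt (\sum_y rgam (g 0%N) (g 0%N) y) + Num.sqrt (2 * eps * n%:R))
  * \sum_x mu x * Num.sqrt (rgam (g 0%N) (g 0%N) x).
Proof.
set E := \sum_x mu x * _; set M := \sum_y _.
have E0 : 0 <= E.
  by apply: sumr_ge0 => x _; rewrite mulr_ge0 ?sqrtr_ge0 ?ltW ?vmeas_gt0.
have step j B : (forall x, Num.sqrt (rgam (g j) (g j) x) <= B) ->
    eps * (\sum_x mu x * rgam (g j) (g 0%N) x) <= eps * (B * E).
  move=> hB; rewrite ler_pM2l // mulr_sumr; apply: ler_sum => x _.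
  rewrite mulrCA ler_pM2l ?vmeas_gt0 //.
  apply: le_trans (rgamma_cauchy sigmaP _ _ _) _.
  by rewrite ler_wpM2r ?sqrtr_ge0.
elim: n => [|n IH].
  rewrite flow_step mulr0 sqrtr0 addr0 -mulrA; apply: step => x.
  by apply: ler_wsqrtr; exact: flow_gradient_bounded.
set a := Num.sqrt (2 * eps * n.+1%:R); set b := Num.sqrt (2 * eps * n%:R) in IH *.
have e2 : 0 < 2 * eps by rewrite mulr_gt0.
have a0 : 0 < a by rewrite sqrtr_gt0 mulr_gt0.
have ab : a ^+ 2 = b ^+ 2 + 2 * eps.
  by rewrite !sqr_sqrtr ?mulr_ge0 // ?ltW // -(natr1 n) mulrDr mulr1.
have b0 : 0 <= b by exact: sqrtr_ge0.
have ba : b <= a by rewrite ler_wsqrtr // ler_pM2l // ler_nat.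
have hB x : Num.sqrt (rgam (g n.+2) (g n.+2) x) <= a^-1.
  rewrite -(sqrtrV (ltW (_ : 0 < 2 * eps * n.+1%:R))) ?mulr_gt0 //.
  apply: ler_wsqrtr; rewrite -[leRHS]mul1r ler_pdivlMr ?mulr_gt0 // mulrC.
  exact: flow_gradient_decay.
have := step _ _ hB; rewrite -flow_step => h1.
suff h2 : eps * (a^-1 * E) <= (a - b) * E by lra.
rewrite mulrA ler_wpM2r // ler_pdivrMr //; nra.
Qed.

End Flow.

(** * Sections as an inner product space, and an eigenbasis of the Laplacian *)

Section Inner.
Variables (R : realType) (V : finType) (G : weighted_graph R V).
Variables (H : structure_group) (d : nat).
Local Notation K := (base_field R H).
Local Notation "a %:K" := (@of_real R H a) (at level 2, format "a %:K").
Local Notation mu := (vmeas G).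
Local Notation vsect := {ffun V -> 'cV[K]_d}.
Implicit Types f g h : vsect.
Local Notation inner := (inner G).

Lemma inner_conj f g : inner g f = conjs (inner f g).
Proof.
rewrite rmorph_sum; apply: eq_bigr => x _.
by rewrite rmorphM /= conjs_of_real -[dot g f x]/(hdot _ _) hdot_conj.
Qed.

Lemma innerDl f g h : inner (f + g) h = inner f h + inner g h.
Proof.
rewrite -big_split; apply: eq_bigr => x _ /=.
rewrite -mulrDr -big_split; congr (_ * _); apply: eq_bigr => i _ /=.
by rewrite ffunE mxE mulrDl.
Qed.

Lemma innerZl a f g : inner (a *: f) g = a * inner f g.
Proof.
rewrite mulr_sumr; apply: eq_bigr => x _.
rewrite mulrCA; congr (_ * _); rewrite mulr_sumr; apply: eq_bigr => i _.
by rewrite ffunE mxE mulrA.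
Qed.

Lemma innerZr a f g : inner f (a *: g) = conjs a * inner f g.
Proof. by rewrite inner_conj innerZl rmorphM /= -inner_conj. Qed.

Lemma inner_suml (I : finType) (F : I -> vsect) g :
  inner (\sum_i F i) g = \sum_i inner (F i) g.
Proof.
elim/big_rec2: _ => [|i a f _ <-]; last exact: innerDl.
by rewrite -(scale0r (0 : vsect)) innerZl mul0r.
Qed.

Lemma inner_sumr (I : finType) (F : I -> vsect) g :
  inner g (\sum_i F i) = \sum_i inner g (F i).
Proof.
rewrite inner_conj inner_suml rmorph_sum; apply: eq_bigr => i _ /=.
by rewrite -inner_conj.
Qed.

Lemma innerBl f g h : inner (f - g) h = inner f h - inner g h.
Proof. by rewrite innerDl -scaleN1r innerZl mulN1r. Qed.

Lemma innerBr f g h : inner f (g - h) = inner f g - inner f h.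
Proof. by rewrite inner_conj innerBl rmorphB /= -!inner_conj. Qed.

Lemma real_part_inner_ge0 f : 0 <= real_part (inner f f).
Proof.
rewrite real_part_inner sumr_ge0 // => x _.
by rewrite mulr_ge0 ?rdot_ge0 // ltW // vmeas_gt0.
Qed.

Definition orthonormal (I : finType) (F : I -> vsect) :=
  forall i j, inner (F i) (F j) = (i == j)%:R.

(** The residual f - sum_i <f, F i> F i has nonnegative squared norm. *)
Lemma bessel (I : finType) (F : I -> vsect) f : orthonormal F ->
  \sum_i modulus (inner (F i) f) ^+ 2 <= real_part (inner f f).
Proof.
move=> oF; set C := \sum_i _.
pose s := \sum_i inner f (F i) *: F i.
have fs : inner f s = C%:K.
  rewrite inner_sumr rmorph_sum; apply: eq_bigr => i _ /=.
  by rewrite innerZr -inner_conj (inner_conj (F i) f) mulr_conjs.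
have ss : inner s s = C%:K.
  rewrite inner_suml rmorph_sum; apply: eq_bigr => i _ /=.
  rewrite innerZl inner_sumr (bigD1 i) //= big1 ?addr0 => [|j ji].
    by rewrite innerZr oF eqxx mulr1 -inner_conj mulrC (inner_conj (F i) f) mulr_conjs.
  by rewrite innerZr oF eq_sym (negPf ji) mulr0.
have := real_part_inner_ge0 (f - s).
rewrite innerBl !innerBr ss fs (inner_conj f s) fs conjs_of_real subrr subr0.
by rewrite raddfB /= real_part_of_real subr_ge0.
Qed.

Local Notation n := #|{: V * 'I_d}|.

(** The factor sqrt (mu x) turns the weighted product into the standard one, for
    which the Laplacian becomes a Hermitian matrix. *)
Definition to_row f : 'rV[K]_n :=
  \row_q ((Num.sqrt (mu (enum_val q).1))%:K * f (enum_val q).1 (enum_val q).2 0).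

Definition of_row (u : 'rV[K]_n) : vsect :=
  [ffun x => \col_i ((Num.sqrt (mu x))^-1%:K * u 0 (enum_rank (x, i)))].

Fact to_row_is_linear : linear to_row.
Proof. by move=> a f g; apply/rowP => q; rewrite !mxE !ffunE !mxE; ring. Qed.

Fact of_row_is_linear : linear of_row.
Proof.
move=> a f g; apply/ffunP => x; apply/colP => i.
by rewrite !(mxE, ffunE); ring.
Qed.

HB.instance Definition _ := GRing.isLinear.Build K vsect 'rV[K]_n _ to_row
  to_row_is_linear.
HB.instance Definition _ := GRing.isLinear.Build K 'rV[K]_n vsect _ of_row
  of_row_is_linear.

Lemma sqrt_vmeas_neq0 x : Num.sqrt (mu x) != 0.
Proof. by rewrite gt_eqF // sqrtr_gt0 vmeas_gt0. Qed.

Lemma to_rowK : cancel to_row of_row.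
Proof.
move=> f; apply/ffunP => x; apply/colP => i; rewrite !(mxE, ffunE) enum_rankK /=.
by rewrite mulrA -rmorphM /= mulVf ?sqrt_vmeas_neq0 // rmorph1 mul1r.
Qed.

Lemma of_rowK : cancel of_row to_row.
Proof.
move=> u; apply/rowP => q; rewrite !(mxE, ffunE) -surjective_pairing enum_valK.
by rewrite mulrA -rmorphM /= mulfV ?sqrt_vmeas_neq0 // rmorph1 mul1r.
Qed.

Lemma to_row_inner f g : (to_row f *m adjmx (to_row g)) 0 0 = inner f g.
Proof.
rewrite mxE (reindex (@enum_rank {: V * 'I_d})) /=; last first.
  by apply: onW_bij; exact: enum_rank_bij.
under eq_bigr => p _ do rewrite !mxE enum_rankK.
rewrite -(pair_bigA _ (fun x i => (Num.sqrt (mu x))%:K * f x i 0 *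
  conjs ((Num.sqrt (mu x))%:K * g x i 0))) /=.
apply: eq_bigr => x _; rewrite mulr_sumr; apply: eq_bigr => i _.
rewrite rmorphM /= conjs_of_real mulrACA -rmorphM /=.
by rewrite -expr2 sqr_sqrtr // ltW // vmeas_gt0.
Qed.

Variable sigma : V -> V -> 'M[K]_d.
Hypothesis sigmaP : is_signature G sigma.
Local Notation Delta := (conn_laplacian G sigma).

Theorem laplacian_eigenbasis : exists (phi : 'I_n -> vsect) (l : 'I_n -> R),
  [/\ orthonormal phi, forall f, f = \sum_j inner f (phi j) *: phi j &
      forall j, Delta (phi j) = - (l j)%:K *: phi j].
Proof.
pose T := lin1_mx (to_row \o Delta \o of_row).
have TE u : u *m T = to_row (Delta (of_row u)) by rewrite mul_rV_lin1.
have hT : adjmx T = T.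
  have e (u v : 'rV[K]_n) : (u *m T *m adjmx v) 0 0 = (u *m adjmx T *m adjmx v) 0 0.
    rewrite -(mulmxA u (adjmx T)) -adjmxM !TE.
    rewrite -{1}(of_rowK v) -{2}(of_rowK u).
    by rewrite !to_row_inner conn_laplacian_selfadjoint.
  apply/matrixP => p q; have := e (delta_mx 0 p) (delta_mx 0 q).
  have -> : adjmx (delta_mx 0 q : 'rV[K]_n) = delta_mx q 0.
    by rewrite /adjmx map_delta_mx trmx_delta.
  by rewrite -!rowE -!colE !mxE => ->.
have [P [l [PP PT]]] := hermitian_eigenbasis hT.
exists (fun j => of_row (row j P)), (fun j => - l j); split.
- move=> i j; rewrite -to_row_inner !of_rowK.
  have -> : (row i P *m adjmx (row j P)) 0 0 = (P *m adjmx P) i j.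
    by rewrite !mxE; apply: eq_bigr => q _; rewrite !mxE.
  by rewrite PP mxE.
- move=> f; apply: (can_inj to_rowK); rewrite linear_sum /=.
  rewrite -[LHS]mulmx1 -(mulmx1C PP) mulmxA mulmx_sum_row.
  apply: eq_bigr => j _; rewrite linearZ /= of_rowK; congr (_ *: _).
  by rewrite -to_row_inner of_rowK !mxE; apply: eq_bigr => q _; rewrite !mxE.
- move=> j; apply: (can_inj to_rowK); rewrite -TE PT rmorphN opprK.
  by rewrite linearZ /= of_rowK.
Qed.

End Inner.

(** * Ky Fan's inequality and the counting of eigenvalues *)

Section Spectrum.
Variables (R : realType) (V : finType) (G : weighted_graph R V).
Variables (H : structure_group) (d : nat).
Local Notation K := (base_field R H).
Local Notation "a %:K" := (@of_real R H a) (at level 2, format "a %:K").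
Local Notation mu := (vmeas G).
Local Notation vsect := {ffun V -> 'cV[K]_d}.
Implicit Types f g h : vsect.
Local Notation inner := (inner G).
Variable sigma : V -> V -> 'M[K]_d.
Hypothesis sigmaP : is_signature G sigma.
Local Notation Delta := (conn_laplacian G sigma).

Variables (I : finType) (phi : I -> vsect) (l : I -> R).
Hypothesis phi_on : orthonormal G phi.
Hypothesis phi_span : forall f, f = \sum_j inner f (phi j) *: phi j.
Hypothesis phi_eigen : forall j, Delta (phi j) = - (l j)%:K *: phi j.

(** By Green's formula l j is the energy of the unit eigensection phi j. *)
Lemma eigenvalue_ge0 j : 0 <= l j.
Proof.
have -> : l j = \sum_x mu x * rgamma G sigma (phi j) (phi j) x.
  rewrite green // phi_eigen innerZl phi_on eqxx mulr1 raddfN /= opprK.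
  by rewrite real_part_of_real.
apply: sumr_ge0 => x _; rewrite mulr_ge0 ?rgamma_ge0 // ltW // vmeas_gt0 //.
Qed.

(** The n-th power of the resolvent (1 - eps Delta)^-1 applied to f. *)
Definition spectral_flow (eps : R) f (n : nat) : vsect :=
  \sum_j (((1 + eps * l j)^-1 ^+ n)%:K * inner f (phi j)) *: phi j.

Lemma spectral_flow0 eps f : spectral_flow eps f 0 = f.
Proof.
rewrite [RHS]phi_span; apply: eq_bigr => j _.
by rewrite expr0 rmorph1 mul1r.
Qed.

Lemma spectral_flowS eps f n : 0 <= eps -> spectral_flow eps f n =
  spectral_flow eps f n.+1 - eps%:K *: Delta (spectral_flow eps f n.+1).
Proof.
move=> eps0; rewrite linear_sum /= scaler_sumr -sumrB; apply: eq_bigr => j _.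
have lj := eigenvalue_ge0 j.
rewrite [Delta (_ *: _)]linearZ /= phi_eigen !scalerA -scalerBl; congr (_ *: _).
have -> : (1 + eps * l j)^-1 ^+ n = (1 + eps * l j)^-1 ^+ n.+1 * (1 + eps * l j).
  by rewrite exprSr mulfVK // gt_eqF // ltr_wpDr // mulr_ge0.
by rewrite rmorphM rmorphD rmorph1 rmorphM /=; ring.
Qed.

Lemma inner_spectral_flow eps f n : real_part (inner (spectral_flow eps f n) f) =
  \sum_j (1 + eps * l j)^-1 ^+ n * modulus (inner f (phi j)) ^+ 2.
Proof.
rewrite inner_suml raddf_sum; apply: eq_bigr => j _ /=.
rewrite innerZl -mulrA [inner (phi j) f]inner_conj mulr_conjs -rmorphM /=.
by rewrite real_part_of_real.
Qed.

(** Write c j for the mass that the test sections put on phi j.  Bessel gives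
    c j <= 1 and Parseval gives sum_j c j = #|J|, so the fewer than #|J|
    eigenvalues below Lam cannot absorb everything: at least one unit of mass
    remains on eigenvalues >= Lam, where the flow contracts by the factor
    (1 + eps * Lam)^-n or better. *)
Lemma ky_fan (J : finType) (F : J -> vsect) (eps Lam : R) n :
    orthonormal G F -> 0 <= eps -> 0 <= Lam ->
    (#|[set j | (l j < Lam)%R]| < #|J|)%N ->
  1 - (1 + eps * Lam)^-1 ^+ n <=
  \sum_p (real_part (inner (F p) (F p))
          - real_part (inner (spectral_flow eps (F p) n) (F p))).
Proof.
move=> oF eps0 Lam0 small.
pose r (t : R) := (1 + eps * t)^-1 ^+ n.
have r_le s t : 0 <= s -> s <= t -> r t <= r s.
  move=> s0 st; have t0 := le_trans s0 st.
  have p q : 0 <= q -> 0 < 1 + eps * q by move=> q0; rewrite ltr_wpDr // mulr_ge0.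
  apply: lerXn2r; rewrite ?nnegrE ?invr_ge0 ?(ltW (p _ _)) //.
  by rewrite lef_pV2 ?posrE ?p // lerD2l ler_wpM2l.
have r_le1 t : 0 <= t -> r t <= 1.
  by move=> t0; rewrite (le_trans (r_le 0 t _ _)) // /r mulr0 addr0 invr1 expr1n.
pose c j := \sum_p modulus (inner (F p) (phi j)) ^+ 2.
have c0 j : 0 <= c j by apply: sumr_ge0 => p _; exact: sqr_ge0.
have c1 j : c j <= 1.
  apply: le_trans (bessel _ oF) _.
  by rewrite phi_on eqxx -(rmorph1 (@of_real R H)) real_part_of_real.
have norm f : real_part (inner f f) = \sum_j modulus (inner f (phi j)) ^+ 2.
  rewrite -{1}(spectral_flow0 0 f) inner_spectral_flow.
  by apply: eq_bigr => j _; rewrite expr0 mul1r.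
have csum : \sum_j c j = #|J|%:R.
  rewrite exchange_big /= -sum1_card natr_sum; apply: eq_bigr => p _.
  by rewrite -norm oF eqxx -(rmorph1 (@of_real R H)) real_part_of_real.
have -> : \sum_p (real_part (inner (F p) (F p))
          - real_part (inner (spectral_flow eps (F p) n) (F p))) =
   \sum_j (1 - r (l j)) * c j.
  transitivity (\sum_p \sum_j (1 - r (l j)) * modulus (inner (F p) (phi j)) ^+ 2).
    apply: eq_bigr => p _; rewrite norm inner_spectral_flow -sumrB.
    by apply: eq_bigr => j _; rewrite mulrBl mul1r.
  by rewrite exchange_big /=; apply: eq_bigr => j _; rewrite mulr_sumr.
rewrite (bigID (fun j => l j < Lam)) /=.
have low : 0 <= \sum_(j | l j < Lam) (1 - r (l j)) * c j.
  by apply: sumr_ge0 => j _; rewrite mulr_ge0 // subr_ge0 r_le1 // eigenvalue_ge0.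
have high : (1 - r Lam) * \sum_(j | ~~ (l j < Lam)) c j <=
    \sum_(j | ~~ (l j < Lam)) (1 - r (l j)) * c j.
  rewrite mulr_sumr; apply: ler_sum => j; rewrite -leNgt => lj.
  by rewrite ler_wpM2r // lerB // r_le.
have lowc : \sum_(j | l j < Lam) c j <= #|[set j | l j < Lam]|%:R.
  rewrite -sum1_card natr_sum.
  rewrite [leRHS](eq_bigl (fun j => l j < Lam)); last by move=> j; rewrite inE.
  by apply: ler_sum => j _; exact: c1.
have : #|[set j | l j < Lam]|.+1%:R <= #|J|%:R :> R by rewrite ler_nat.
rewrite -natr1 -csum (bigID (fun j => l j < Lam) predT c) /= => hc.
have : (1 - r Lam) * 1 <= (1 - r Lam) * \sum_(j | ~~ (l j < Lam)) c j.
  by rewrite ler_wpM2l ?subr_ge0 ?r_le1 //; lra.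
rewrite mulr1 => h; apply: le_trans h _; apply: le_trans high _.
by rewrite lerDr.
Qed.

(** The phi j with l j = a are orthonormal, hence free, in the eigenspace. *)
Lemma dim_eigenvalue_space a :
  (#|[set j | (l j == a)%R]| <= \dim (eigenvalue_space G sigma a))%N.
Proof.
set A := [set j | _].
pose X := [tuple phi (tnth (enum_tuple A) i) | i < #|A|].
have fX : free X.
  apply/freeP => k.
  rewrite (eq_bigr (fun i => k i *: phi (tnth (enum_tuple A) i))); last first.
    by move=> i _; rewrite -tnth_nth tnth_mktuple.
  move=> e i; have := congr1 (fun f => inner f (phi (tnth (enum_tuple A) i))) e.
  have -> : inner 0 (phi (tnth (enum_tuple A) i)) = 0.
    by rewrite -(scale0r (0 : vsect)) innerZl mul0r.
  rewrite inner_suml (bigD1 i) //= big1 ?addr0; last first.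
    move=> j ji; rewrite innerZl phi_on.
    suff /negPf -> : tnth (enum_tuple A) j != tnth (enum_tuple A) i by rewrite mulr0.
    apply: contra ji => /eqP /(tuple_uniqP _ _) -> //.
    exact: enum_uniq.
  by rewrite innerZl phi_on eqxx mulr1.
have /eqP <- : \dim <<X>>%VS == #|A| by move: fX; rewrite /free size_tuple.
apply: dimvS; apply/span_subvP => f /tnthP[i ->]; rewrite tnth_mktuple.
have : tnth (enum_tuple A) i \in A by rewrite -mem_enum; exact: mem_tnth.
rewrite inE => /eqP e.
rewrite /eigenvalue_space /passmx.leigenspace memv_ker add_lfunE opp_lfunE scale_lfunE.
by rewrite id_lfunE lfunE /= phi_eigen e subrr.
Qed.

Lemma sorted_flatten_nseq (s : seq R) (n : R -> nat) :
  sorted <=%O s -> sorted <=%O (flatten [seq nseq (n a) a | a <- s]).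
Proof.
rewrite !(sorted_pairwise le_trans); elim: s => [//|a s IH] /= /andP[as_ ss].
rewrite pairwise_cat IH // andbT; apply/andP; split.
  apply/allrelP => x y /nseqP[-> _] /flattenP[z /mapP[b bs ->] /nseqP[-> _]].
  by have /allP := as_; exact.
by elim: (n a) => //= k ->; rewrite all_nseq lexx orbT.
Qed.

Lemma count_lt_nth (s : seq R) i : sorted <=%O s -> (i < size s)%N ->
  (count (fun a => (a < nth 0 s i)%R) s <= i)%N.
Proof.
move=> ss si; rewrite -{2}(cat_take_drop i s) count_cat.
rewrite [X in (_ + X)%N](_ : _ = 0%N) ?addn0.
  by apply: leq_trans (count_size _ _) _; rewrite size_take si.
apply/eqP; rewrite -leqn0 leqNgt -has_count; apply/hasPn => a.
move=> /(nthP 0)[j]; rewrite size_drop nth_drop => js <-.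
rewrite -leNgt; apply: (sorted_leq_nth le_trans lexx 0 ss) => //.
- by rewrite inE -ltn_subRL.
- exact: leq_addr.
Qed.

(** The number of j with l j < Lam is at most the number of entries below Lam in
    the spectrum, and the spectrum is sorted with Lam at position m - 1.  A
    positive value of lambda_ cannot be a default value of nth, so the position
    is valid; this also forces the set of eigenvalues to be finite, since
    fset_set sends an infinite set to the empty one. *)
Lemma card_eigenvalues_below (m : nat) : 0 < lambda_ G sigma m ->
  (#|[set j | (l j < lambda_ G sigma m)%R]| <= m.-1)%N.
Proof.
rewrite /lambda_; set s := spectrum G sigma; set Lam := nth 0 s m.-1 => Lam0.
have ms : (m.-1 < size s)%N.
  by rewrite ltnNge; apply: contraL Lam0 => ms; rewrite /Lam nth_default // ltxx.
set t := sort <=%O (fset_set (eigenvalue_set G sigma)).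
have sE : s = flatten [seq nseq (\dim (eigenvalue_space G sigma a)) a | a <- t] by [].
have st : sorted <=%O t by exact: sort_le_sorted.
apply: leq_trans (count_lt_nth (sorted_flatten_nseq _ st) ms); rewrite -sE -/Lam.
have fin : finite_set (eigenvalue_set G sigma).
  apply: contrapT => nf; move: ms; rewrite sE /t /fset_set.
  by case: pselect => // nfi; rewrite /= ltn0.
have lt j : l j \in t.
  rewrite mem_sort in_fset_set // inE; exists (phi j); last exact: phi_eigen.
  apply/eqP => e; have := phi_on j j.
  rewrite eqxx e -(scale0r (0 : vsect)) innerZl mul0r.
  by move/eqP; rewrite eq_sym oner_eq0.
have ut : uniq t by rewrite sort_uniq fset_uniq.
rewrite sE count_flatten -map_comp sumnE big_map.
have one j : (\sum_(a <- t) (l j == a)%R * (a < Lam)%R = (l j < Lam)%R)%N.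
  rewrite (bigD1_seq (l j)) //= eqxx mul1n big1 ?addn0 // => a.
  by rewrite eq_sym => /negPf ->.
rewrite -sum1_card big_mkcond /=.
rewrite (eq_bigr (fun j => \sum_(a <- t) (l j == a)%R * (a < Lam)%R)%N); last first.
  by move=> j _; rewrite one inE; case: (l j < Lam)%R.
rewrite exchange_big /=; apply: leq_sum => a _.
rewrite count_nseq -big_distrl /= mulnC leq_mul2l.
apply/orP; right; apply: leq_trans (dim_eigenvalue_space a).
rewrite -sum1_card [X in (_ <= X)%N]big_mkcond /=.
by apply: leq_sum => j _; rewrite inE; case: (_ == _).
Qed.

End Spectrum.

(** * Frames as test sections *)

Section Isoperimetry.
Variables (R : realType) (V : finType) (G : weighted_graph R V).
Variables (H : structure_group) (d : nat).
Local Notation K := (base_field R H).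
Local Notation "a %:K" := (@of_real R H a) (at level 2, format "a %:K").
Local Notation "x ~~> y" := (adj G x y) (at level 70).
Local Notation w := (weight G).
Local Notation mu := (vmeas G).
Local Notation vsect := {ffun V -> 'cV[K]_d}.
Implicit Types f g h : vsect.
Local Notation inner := (inner G).
Variable sigma : V -> V -> 'M[K]_d.
Hypothesis sigmaP : is_signature G sigma.

Definition vnorm (u : 'cV[K]_d) : R := Num.sqrt (rdot u u).

Lemma vnorm_sqr u : vnorm u ^+ 2 = rdot u u.
Proof. by rewrite sqr_sqrtr ?rdot_ge0. Qed.

Lemma weight_ge0 x y : 0 <= w x y.
Proof.
by have [xy|/weight_eq0 ->//] := boolP (x ~~> y); rewrite ltW // weight_gt0.
Qed.

Lemma Dnor_ge0 : 0 <= Dnor G.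
Proof. by rewrite /Dnor bigmax_ge_id. Qed.

Lemma vmeas_le_Dnor x y : x ~~> y -> mu x <= Dnor G * w x y.
Proof.
move=> xy; rewrite -ler_pdivrMr ?weight_gt0 // /Dnor.
apply: le_trans (le_bigmax _ _ x).
exact: (le_bigmax_cond 0 (fun y => mu x / w x y) xy).
Qed.

Lemma sum_sqr_le (I : finType) (P : pred I) (a : I -> R) :
  (forall i, P i -> 0 <= a i) ->
  \sum_(i | P i) a i ^+ 2 <= (\sum_(i | P i) a i) ^+ 2.
Proof.
move=> a0; rewrite expr2 mulr_suml; apply: ler_sum => i Pi.
rewrite expr2 ler_wpM2l ?a0 // (bigD1 i) //= lerDl sumr_ge0 // => j /andP[Pj _].
exact: a0.
Qed.

(** The Euclidean norm of the numbers w x y * |edge difference| is at most their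
    sum, and mu x <= D * w x y supplies the missing factor w x y. *)
Lemma sqrt_rgamma_le f x : mu x * Num.sqrt (rgamma G sigma f f x) <=
  2^-1 * Num.sqrt (2 * Dnor G)
  * \sum_(y | x ~~> y) w x y * vnorm (edge_diff sigma f x y).
Proof.
set s := \sum_(y | _) _.
have mu0 := vmeas_gt0 G x; have D0 := Dnor_ge0.
have s0 : 0 <= s.
  by apply: sumr_ge0 => y _; rewrite mulr_ge0 ?sqrtr_ge0 ?weight_ge0.
rewrite -ler_sqr ?nnegrE ?mulr_ge0 ?sqrtr_ge0 ?(ltW mu0) ?invr_ge0 //.
rewrite !exprMn !sqr_sqrtr ?rgamma_ge0 ?mulr_ge0 // rgammaE //.
have -> : mu x ^+ 2 * ((2 * mu x)^-1 * \sum_(y | x ~~> y)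
    w x y * rdot (edge_diff sigma f x y) (edge_diff sigma f x y)) =
  2^-1 * \sum_(y | x ~~> y) mu x * (w x y * vnorm (edge_diff sigma f x y) ^+ 2).
  rewrite -mulr_sumr; under [in RHS]eq_bigr do rewrite vnorm_sqr.
  by field; rewrite gt_eqF.
have -> : 2^-1 ^+ 2 * (2 * Dnor G) * s ^+ 2 = 2^-1 * (Dnor G * s ^+ 2) by field.
rewrite ler_pM2l ?invr_gt0 //.
have := sum_sqr_le (P := fun y => x ~~> y)
  (a := fun y => w x y * vnorm (edge_diff sigma f x y)).
move/(_ _)/(ler_wpM2l D0) => h; apply: le_trans (h _); last first.
  by move=> y _; rewrite mulr_ge0 ?sqrtr_ge0 ?weight_ge0.
rewrite mulr_sumr; apply: ler_sum => y xy.
rewrite (_ : Dnor G * _ = Dnor G * w x y *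
  (w x y * vnorm (edge_diff sigma f x y) ^+ 2)); last by ring.
by rewrite ler_wpM2r ?vmeas_le_Dnor // mulr_ge0 ?weight_ge0 // sqr_ge0.
Qed.

Variables (S : {set V}) (tau : V -> 'M[K]_d).
Hypothesis tauP : forall x, x \in S -> in_group (tau x).

Definition frame_section (i : 'I_d) : vsect :=
  [ffun x => if x \in S then col i (tau x) else 0].

Lemma rdot_frame i x : rdot (frame_section i x) (frame_section i x) = (x \in S)%:R.
Proof.
rewrite ffunE; case: ifP => xS; last by rewrite rdot0.
rewrite /rdot (in_group_hdot_col _ _ (tauP xS)) eqxx -(rmorph1 (@of_real R H)).
by rewrite real_part_of_real.
Qed.

Lemma inner_frame i j :
  inner (frame_section i) (frame_section j) = (\sum_(x in S) mu x)%:K * (i == j)%:R.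
Proof.
rewrite rmorph_sum mulr_suml [RHS]big_mkcond; apply: eq_bigr => x _ /=.
rewrite -[dot _ _ _]/(hdot _ _) !ffunE; case: ifP => xS; last first.
  by rewrite hdot0r mulr0.
by rewrite (in_group_hdot_col _ _ (tauP xS)).
Qed.

Lemma vnorm_isometry (A : 'M[K]_d) u : in_group A -> vnorm (A *m u) = vnorm u.
Proof. by move=> hA; rewrite /vnorm /rdot hdot_isometry. Qed.

Lemma vnormN u : vnorm (- u) = vnorm u.
Proof.
congr Num.sqrt; rewrite -scaleN1r -(rmorphN1 (@of_real R H)).
by rewrite rdotZl rdotZr mulN1r mulN1r opprK.
Qed.

(** The isometry sigma x y carries the edge difference read from y to the
    opposite of the one read from x. *)
Lemma vnorm_edge_diffC f x y : x ~~> y ->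
  vnorm (edge_diff sigma f y x) = vnorm (edge_diff sigma f x y).
Proof.
move=> xy; have [gA e] := sigmaP xy.
rewrite -(vnorm_isometry _ gA) /edge_diff mulmxBr e mulmxA mulmxV.
  by rewrite mul1mx -vnormN opprB.
by have [] := mulmx1_unit gA.
Qed.

Lemma vnorm_frame i x : vnorm (frame_section i x) = (x \in S)%:R.
Proof. by rewrite /vnorm rdot_frame; case: (_ \in _); rewrite ?sqrtr1 ?sqrtr0. Qed.

Lemma sum_symmetric_pairs (a : V -> V -> R) :
  (forall x y, a x y = a y x) -> (forall x, a x x = 0) ->
  \sum_(x in S) \sum_(y in S) a x y =
  2 * \sum_(x in S) \sum_(y in S | (enum_rank x < enum_rank y)%N) a x y.
Proof.
move=> aC a0; set h := (X in 2 * X).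
have e : \sum_(x in S) \sum_(y in S | (enum_rank y < enum_rank x)%N) a x y = h.
  rewrite (exchange_big_dep (fun y => y \in S)) /=; last by move=> x y _ /andP[].
  apply: eq_bigr => x xS; apply: eq_big => [y|y _]; last exact: aC.
  by rewrite xS.
rewrite mulrDl mul1r -{2}e -big_split /=; apply: eq_bigr => x _.
rewrite (bigID (fun y => (enum_rank x < enum_rank y)%N)) /=; congr (_ + _).
rewrite (bigID (fun y => y == x)) /= [X in X + _]big1 ?add0r.
  apply: eq_bigl => y; rewrite -leqNgt ltn_neqAle -andbA; congr (_ && _).
  by rewrite andbC -(inj_eq enum_rank_inj).
by move=> y /andP[_ /eqP ->].
Qed.

(** Pairs inside S are counted twice, once per orientation; pairs across the
    boundary of S also appear in both orientations, each with an edge difference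
    of norm 1; the other pairs contribute 0. *)
Lemma sum_edges_frame i :
  \sum_x \sum_(y | x ~~> y) w x y * vnorm (edge_diff sigma (frame_section i) x y)
  = 2 * (\sum_(x in S) \sum_(y in S | (x ~~> y) && (enum_rank x < enum_rank y)%N)
      w x y * vnorm (col i (sigma x y *m tau y - tau x)) + boundary G S).
Proof.
pose f := frame_section i.
pose a x y := if x ~~> y then w x y * vnorm (edge_diff sigma f x y) else 0.
have aC x y : a x y = a y x.
  rewrite /a adj_sym weight_sym; case: ifP => // yx.
  by rewrite vnorm_edge_diffC // adj_sym.
have aout x y : x \in S -> y \notin S -> a x y = w x y.
  move=> xS yS; rewrite /a; case: ifPn => [xy|/weight_eq0 -> //].
  rewrite /edge_diff [f y]ffunE (negPf yS) mulmx0 sub0r vnormN vnorm_frame xS.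
  by rewrite mulr1.
have a00 x y : x \notin S -> y \notin S -> a x y = 0.
  move=> xS yS; rewrite /a /edge_diff [f y]ffunE (negPf yS) mulmx0 sub0r vnormN.
  by rewrite vnorm_frame (negPf xS) mulr0 if_same.
have -> : \sum_x \sum_(y | x ~~> y) w x y * vnorm (edge_diff sigma f x y) =
    \sum_x \sum_y a x y.
  by apply: eq_bigr => x _; rewrite big_mkcond.
have sp x : \sum_y a x y = \sum_(y in S) a x y + \sum_(y in ~: S) a x y.
  rewrite (bigID (fun y => y \in S)) /=; congr (_ + _).
  by apply: eq_bigl => y; rewrite inE.
have b1 : \sum_(x in S) \sum_(y in ~: S) a x y = boundary G S.
  apply: eq_bigr => x xS; apply: eq_bigr => y; rewrite inE => yS.
  exact: aout.
have b2 : \sum_(x | x \notin S) \sum_y a x y = boundary G S.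
  rewrite -b1 [RHS]exchange_big /=.
  rewrite [LHS](eq_bigr (fun x => \sum_(y in S) a y x)).
    by apply: eq_bigl => x; rewrite inE.
  move=> x xS; rewrite sp [X in _ + X]big1 ?addr0 => [|y].
    by apply: eq_bigr => y _; exact: aC.
  by rewrite inE => yS; rewrite a00.
have b0 : \sum_(x in S) \sum_(y in S) a x y = 2 * \sum_(x in S)
    \sum_(y in S | (x ~~> y) && (enum_rank x < enum_rank y)%N)
      w x y * vnorm (col i (sigma x y *m tau y - tau x)).
  rewrite sum_symmetric_pairs // => [|x]; last by rewrite /a adj_irr.
  congr (_ * _); apply: eq_bigr => x xS.
  rewrite (bigID (fun y => x ~~> y)) /= [X in _ + X]big1 ?addr0 => [|y]; last first.
    by move=> /andP[_ /negPf xy]; rewrite /a xy.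
  apply: eq_big => [y|y /andP[/andP[yS _] xy]].
    by rewrite -andbA [X in _ && X]andbC.
  rewrite /a xy; congr (_ * vnorm _).
  by rewrite /edge_diff !ffunE xS yS linearB /= !colE mulmxA.
rewrite (bigID (fun x => x \in S)) /= b2.
by rewrite (eq_bigr _ (fun x _ => sp x)) big_split /= b0 b1; ring.
Qed.

Lemma norm21E (A : 'M[K]_d) : norm21 A = d%:R^-1 * \sum_(i < d) vnorm (col i A).
Proof.
congr (_ * _); apply: eq_bigr => i _; congr Num.sqrt; rewrite rdot_modulus.
by apply: eq_bigr => j _; rewrite mxE.
Qed.

Lemma frustration_cost_ge0 T t : 0 <= frustration_cost G sigma T t.
Proof.
apply: sumr_ge0 => x _; apply: sumr_ge0 => y _; rewrite mulr_ge0 ?weight_ge0 //.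
by rewrite norm21E mulr_ge0 ?invr_ge0 // sumr_ge0 // => i _; exact: sqrtr_ge0.
Qed.

(** Sum over the columns: norm21 is the mean of the column norms, whence the
    factor d. *)
Lemma frame_energy_le : (0 < d)%N ->
  \sum_(i < d) \sum_x mu x * Num.sqrt
     (rgamma G sigma (frame_section i) (frame_section i) x) <=
  Num.sqrt (2 * Dnor G) * (d%:R * (frustration_cost G sigma S tau + boundary G S)).
Proof.
move=> d0; have -> : d%:R * (frustration_cost G sigma S tau + boundary G S) =
  \sum_(i < d) (\sum_(x in S)
      \sum_(y in S | (x ~~> y) && (enum_rank x < enum_rank y)%N)
      w x y * vnorm (col i (sigma x y *m tau y - tau x)) + boundary G S).
  rewrite big_split /= sumr_const card_ord mulrDr [X in _ + X]mulr_natl; congr (_ + _).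
  rewrite [RHS]exchange_big mulr_sumr; apply: eq_bigr => x _.
  rewrite [RHS]exchange_big mulr_sumr; apply: eq_bigr => y _.
  by rewrite norm21E -mulr_sumr mulrCA mulVKf // pnatr_eq0 -lt0n.
rewrite mulr_sumr; apply: ler_sum => i _.
apply: le_trans (ler_sum _ (fun x _ => sqrt_rgamma_le (frame_section i) x)) _.
by rewrite -mulr_sumr sum_edges_frame mulrA; set q := Num.sqrt _; lra.
Qed.

End Isoperimetry.

(** * Numerical constants *)

Section Constants.
Variable R : realType.

(** Bernoulli's inequality for M steps gives (1 + 1 / (12 M))^M >= 13 / 12, and
    (13 / 12)^12 >= 13 / 5.  Multiples of 12 are used so that this crude form of
    the monotonicity of (1 + 1 / n)^n is enough. *)
Lemma decay_constant (M : nat) : (0 < M)%N ->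
  8 / 13 <= 1 - (1 + ((12 * M)%:R : R)^-1)^-1 ^+ (12 * M).
Proof.
move=> M0; have Mr : 0 < M%:R :> R by rewrite ltr0n.
set x := ((12 * M)%:R)^-1; have x0 : 0 < x by rewrite invr_gt0 natrM mulr_gt0.
have bernoulli n : 1 + n%:R * x <= (1 + x) ^+ n.
  elim: n => [|n IH]; first by rewrite mul0r addr0 expr0.
  rewrite exprS -natr1; have : 0 <= n%:R * x by rewrite mulr_ge0 // ltW.
  have := ler_wpM2l (ltW (addr_gt0 ltr01 x0)) IH; nra.
have h : 13 / 12 <= (1 + x) ^+ M.
  apply: le_trans (bernoulli M); rewrite /x natrM invfM.
  by rewrite mulrCA mulfV ?gt_eqF //; lra.
have h2 : 13 / 5 <= (1 + x) ^+ (12 * M).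
  rewrite mulnC exprM.
  have : (13 / 12) ^+ 12 <= ((1 + x) ^+ M) ^+ 12.
    by apply: lerXn2r; rewrite ?nnegrE //; lra.
  by apply: le_trans; lra.
rewrite exprVn; have : ((1 + x) ^+ (12 * M))^-1 <= (13 / 5)^-1.
  by rewrite lef_pV2 // posrE; lra.
by rewrite invf_div; lra.
Qed.

(** From exp (- 1 / 18) >= 17 / 18 one gets exp (2 / 3) <= (18 / 17)^12 <= 2. *)
Lemma ln2_ge : 2 / 3 <= ln (2 : R).
Proof.
have h : expR (18^-1) <= 18 / 17 :> R.
  have := expR_ge1Dx (- 18^-1 : R); rewrite expRN => h.
  have : ((expR (18^-1 : R))^-1)^-1 <= (1 + - 18^-1)^-1.
    by rewrite lef_pV2 // posrE ?invr_gt0 ?expR_gt0 //; lra.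
  have -> : (1 + - 18^-1 : R)^-1 = 18 / 17 by field.
  by rewrite invrK.
rewrite -[leLHS]expRK ler_ln ?posrE ?expR_gt0 //.
have -> : (2 / 3 : R) = 12%:R * 18^-1 by field.
rewrite expRM_natl.
have : expR (18^-1) ^+ 12 <= (18 / 17) ^+ 12 :> R.
  by apply: lerXn2r; rewrite ?nnegrE ?expR_ge0 //; lra.
by move/le_trans; apply; lra.
Qed.

End Constants.

(** * The lower bound for a family of disjoint sets *)

Section Buser.
Variables (R : realType) (V : finType) (G : weighted_graph R V).
Variables (H : structure_group) (d : nat).
Local Notation K := (base_field R H).
Local Notation "a %:K" := (@of_real R H a) (at level 2, format "a %:K").
Local Notation mu := (vmeas G).
Local Notation vsect := {ffun V -> 'cV[K]_d}.
Implicit Types f g h : vsect.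
Local Notation inner := (inner G).
Variable sigma : V -> V -> 'M[K]_d.
Hypothesis sigmaP : is_signature G sigma.
Hypothesis cd : CD0oo G sigma.
Hypothesis d_gt0 : (0 < d)%N.

Variables (I : finType) (phi : I -> vsect) (l : I -> R).
Hypothesis phi_on : orthonormal G phi.
Hypothesis phi_span : forall f, f = \sum_j inner f (phi j) *: phi j.
Hypothesis phi_eigen : forall j,
  conn_laplacian G sigma (phi j) = - (l j)%:K *: phi j.

Variables (k : nat) (S : 'I_k -> {set V}) (Lam : R).
Hypothesis S_disjoint : disjoint_family S.
Hypothesis Lam_gt0 : 0 < Lam.
Hypothesis Lam_low : (#|[set j | (l j < Lam)%R]| < k * d)%N.

Local Notation vol p := (\sum_(x in S p) mu x).

Lemma vol_gt0 p : 0 < vol p.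
Proof.
have [/(_ p) /set0Pn[x xS] _] := S_disjoint.
rewrite (bigD1 x) //= ltr_wpDr ?vmeas_gt0 // sumr_ge0 // => y _.
by rewrite ltW // vmeas_gt0.
Qed.

(** Compare Ky Fan's lower bound and the displacement estimate for the frames
    normalised by sqrt (mu (S p)), for 12 M Euler steps of total time 1 / Lam.
    Letting M grow removes the contribution C of the first step. *)
Lemma frames_lower_bound (tau : 'I_k -> V -> 'M[K]_d) :
  (forall p x, x \in S p -> in_group (tau p x)) ->
  8 / 13 * Num.sqrt Lam <= 2 * Num.sqrt (Dnor G) *
    (d%:R * \sum_p (frustration_cost G sigma (S p) (tau p) + boundary G (S p)) / vol p).
Proof.
move=> tauP; set Q := \sum_p _.
pose f (q : 'I_k * 'I_d) := frame_section (S q.1) (tau q.1) q.2.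
pose c (q : 'I_k * 'I_d) : R := (Num.sqrt (vol q.1))^-1.
pose F q := (c q)%:K *: f q.
pose flow eps := spectral_flow G phi l eps.
have c2 q : c q * c q = (vol q.1)^-1.
  by rewrite -invfM -expr2 sqr_sqrtr // ltW // vol_gt0.
have oF : orthonormal G F.
  move=> q r; rewrite innerZl innerZr conjs_of_real.
  case: (eqVneq q.1 r.1) => [e|ne].
    have -> : inner (f q) (f r) = (vol q.1)%:K * (q.2 == r.2)%:R.
      by rewrite /f -e inner_frame //; exact: tauP.
    rewrite /c -e -/(c q) !mulrA -!rmorphM /= c2 mulVf; last first.
      by rewrite gt_eqF // vol_gt0.
    rewrite rmorph1 mul1r; case: q r e => [p i] [p' j] /= <-.
    by rewrite xpair_eqE eqxx.
  have -> : (q == r) = false by apply: contraNF ne => /eqP ->.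
  rewrite (_ : inner _ _ = 0) ?mulr0 //; apply: big1 => x _.
  have [_ /(_ _ _ ne) dis] := S_disjoint.
  rewrite -[dot _ _ _]/(hdot _ _) !ffunE; case: ifP => xq; last first.
    by rewrite hdot_conj hdot0r rmorph0 mulr0.
  by rewrite (disjointFr dis xq) hdot0r mulr0.
have f1 q x : rdot (f q x) (f q x) <= 1.
  by rewrite /f rdot_frame; [case: (_ \in _); rewrite ?lexx ?ler01 | exact: tauP].
pose E q := \sum_x mu x * Num.sqrt (rgamma G sigma (f q) (f q) x).
pose C := \sum_q Num.sqrt (\sum_y rgamma G sigma (f q) (f q) y).
have E0 q : 0 <= E q.
  by apply: sumr_ge0 => x _; rewrite mulr_ge0 ?sqrtr_ge0 // ltW // vmeas_gt0.
have C0 : 0 <= C by apply: sumr_ge0 => q _; exact: sqrtr_ge0.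
have displ eps n q : 0 < eps ->
    real_part (inner (f q) (f q))
      - real_part (inner (flow eps (f q) n.+1) (f q)) <=
    (eps * C + Num.sqrt (2 * eps * n%:R)) * E q.
  move=> e0.
  have := flow_displacement sigmaP cd e0
    (fun j => spectral_flowS sigmaP phi_on phi_eigen (f q) j (ltW e0)) _ n.
  rewrite spectral_flow0 // => /(_ (f1 q)) h; apply: le_trans h _.
  apply: ler_wpM2r; first exact: E0.
  rewrite lerD2r ler_pM2l //.
  by rewrite /C (bigD1 q) //= lerDl sumr_ge0 // => r _; exact: sqrtr_ge0.
have scale eps n q :
    real_part (inner (F q) (F q)) - real_part (inner (flow eps (F q) n) (F q)) =
    (vol q.1)^-1 * (real_part (inner (f q) (f q))
                    - real_part (inner (flow eps (f q) n) (f q))).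
  have -> : flow eps (F q) n = (c q)%:K *: flow eps (f q) n.
    rewrite scaler_sumr; apply: eq_bigr => j _.
    by rewrite innerZl scalerA mulrCA.
  rewrite !innerZl !innerZr conjs_of_real !real_partZ -c2; ring.
have energy : \sum_q (vol q.1)^-1 * E q <= Num.sqrt (2 * Dnor G) * (d%:R * Q).
  rewrite -(pair_bigA _ (fun p i => (vol p)^-1 * E (p, i))) /=.
  have -> : Num.sqrt (2 * Dnor G) * (d%:R * Q) = \sum_p (vol p)^-1 *
      (Num.sqrt (2 * Dnor G) *
       (d%:R * (frustration_cost G sigma (S p) (tau p) + boundary G (S p)))).
    by rewrite /Q !mulr_sumr; apply: eq_bigr => p _; ring.
  apply: ler_sum => p _; rewrite -mulr_sumr ler_pM2l ?invr_gt0 ?vol_gt0 //.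
  exact: (frame_energy_le sigmaP (tauP p) d_gt0).
set W := \sum_q _ in energy.
have W0 : 0 <= W by apply: sumr_ge0 => q _; rewrite mulr_ge0 // invr_ge0 ltW // vol_gt0.
have step M : (0 < M)%N ->
    8 / 13 <= (Lam^-1 / (12 * M)%:R * C + Num.sqrt (2 / Lam)) * W.
  move=> M0; set N := (12 * M)%N; set eps := Lam^-1 / N%:R.
  have N0 : (0 < N)%N by rewrite muln_gt0.
  have Nr : 0 < N%:R :> R by rewrite ltr0n.
  have e0 : 0 < eps by rewrite divr_gt0 // invr_gt0.
  apply: le_trans (decay_constant R M0) _.
  have -> : ((12 * M)%:R)^-1 = eps * Lam :> R.
    by rewrite /eps mulrAC mulVf ?mul1r ?gt_eqF.
  have small : (#|[set j | (l j < Lam)%R]| < #|{: 'I_k * 'I_d}|)%N.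
    by rewrite card_prod !card_ord.
  apply: le_trans (ky_fan sigmaP phi_on phi_span phi_eigen N oF (ltW e0)
    (ltW Lam_gt0) small) _.
  rewrite mulr_sumr; apply: ler_sum => q _.
  rewrite -/(flow _ _ _) scale mulrCA ler_pM2l ?invr_gt0 ?vol_gt0 //.
  rewrite -(prednK N0); apply: le_trans (displ _ _ _ e0) _.
  rewrite ler_wpM2r // lerD2l; apply: ler_wsqrtr.
  have -> : 2 / Lam = 2 * eps * N%:R by rewrite /eps; field; rewrite !gt_eqF.
  by apply: ler_wpM2l; [rewrite mulr_ge0 // ltW | rewrite ler_nat leq_pred].
have limit : 8 / 13 <= Num.sqrt (2 / Lam) * W.
  apply/ler_addgt0Pr => e e0.
  (* The error term is a / M, below e for M large. *)
  pose a := Lam^-1 * C * W / 12.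
  have := truncnS_gt (a / e); set M := (Num.truncn _).+1 => aM.
  have Mr : 0 < M%:R :> R by rewrite ltr0n.
  have h : a / M%:R <= e by rewrite ler_pdivrMr // mulrC -ler_pdivrMr // ltW.
  apply: le_trans (step M isT) _; rewrite mulrDl [leRHS]addrC lerD2r.
  apply: le_trans h; rewrite natrM /a invfM.
  by rewrite le_eqVlt; apply/orP; left; apply/eqP; field; rewrite !gt_eqF.
have L0 := ltW Lam_gt0; have sL0 : 0 <= Num.sqrt Lam by exact: sqrtr_ge0.
apply: le_trans (ler_wpM2r sL0 limit) _.
rewrite mulrAC -sqrtrM ?divr_ge0 // divfK ?gt_eqF //.
apply: le_trans (ler_wpM2l (sqrtr_ge0 2) energy) _.
have e : Num.sqrt 2 * Num.sqrt (2 * Dnor G) = 2 * Num.sqrt (Dnor G).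
  by rewrite sqrtrM // mulrA -expr2 sqr_sqrtr.
by rewrite [leLHS]mulrA e.
Qed.

(** The frames may be taken within del of the infimum that defines the
    frustration; the resulting error is at most e for the chosen del. *)
Lemma cheeger_lower_bound :
  8 / 13 * Num.sqrt Lam <= 2 * Num.sqrt (Dnor G) *
    ((k * d)%:R * \big[Num.max/0]_(p < k) Defs.phi G sigma (S p)).
Proof.
set m := \big[_/_]_(_ < _) _.
pose A := 2 * Num.sqrt (Dnor G) * d%:R.
have A0 : 0 <= A by rewrite !mulr_ge0 ?sqrtr_ge0.
have B0 : 0 <= \sum_p (vol p)^-1.
  by apply: sumr_ge0 => p _; rewrite invr_ge0 ltW // vol_gt0.
apply/ler_addgt0Pr => e e0.
pose del := e / (1 + A * \sum_p (vol p)^-1).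
have den : 0 < 1 + A * \sum_p (vol p)^-1 by rewrite ltr_wpDr // mulr_ge0.
have del0 : 0 < del by rewrite divr_gt0.
have near p : exists t : V -> 'M[K]_d, (forall x, x \in S p -> in_group (t x)) /\
    frustration_cost G sigma (S p) t < frustration G sigma (S p) + del.
  have [_ [t tP <-] lt] : exists2 c, [set frustration_cost G sigma (S p) tau |
        tau in [set tau : V -> 'M[K]_d |
                 forall x, x \in S p -> in_group (tau x)]]%classic c &
       c < frustration G sigma (S p) + del.
    apply: inf_adherent => //; split.
      exists (frustration_cost G sigma (S p) (fun=> 1%:M)), (fun=> 1%:M) => // x _.
      by rewrite /in_group map_mx1 trmx1 mulmx1.
    exists 0 => _ [t _ <-]; exact: frustration_cost_ge0.
  by exists t.
have [tau tauP] := choice near.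
apply: le_trans (frames_lower_bound (fun p => (tauP p).1)) _.
have -> : 2 * Num.sqrt (Dnor G) * ((k * d)%:R * m) = A * (\sum_(p < k) m).
  by rewrite sumr_const card_ord /A natrM -[m *+ k]mulr_natl; ring.
rewrite mulrA -/A.
have le p : (frustration_cost G sigma (S p) (tau p) + boundary G (S p)) / vol p
    <= m + del * (vol p)^-1.
  apply: le_trans (_ : (frustration G sigma (S p) + del + boundary G (S p)) / vol p <= _).
    by rewrite ler_pM2r ?invr_gt0 ?vol_gt0 // lerD2r ltW // (tauP p).2.
  rewrite addrAC mulrDl lerD2r.
  exact: (le_bigmax 0 (fun p => Defs.phi G sigma (S p)) p).
apply: le_trans (ler_wpM2l A0 (ler_sum _ (fun p _ => le p))) _.
rewrite big_split /= -mulr_sumr mulrDr lerD2l mulrCA.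
rewrite /del mulrAC ler_pdivrMr // ler_pM2l // lerDr //.
Qed.

End Buser.

(** * The Buser inequality *)

(** Singletons; the infimum defining the Cheeger constant is then over a
    nonempty set. *)
Lemma disjoint_family_exists (V : finType) k : (k <= #|V|)%N ->
  exists S : 'I_k -> {set V}, disjoint_family S.
Proof.
move=> kV; exists (fun i => [set enum_val (widen_ord kV i)]); split=> [i|i j ij].
  by apply/set0Pn; exists (enum_val (widen_ord kV i)); rewrite inE.
rewrite disjoints1 inE; apply: contra ij => /eqP/enum_val_inj e.
by apply/eqP/val_inj; have := congr1 val e.
Qed.

Lemma Dnor_gt0 (R : realType) (V : finType) (G : weighted_graph R V) :
  (exists x y, adj G x y) -> 0 < Dnor G.
Proof.
move=> [x [y xy]]; have := vmeas_le_Dnor xy.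
move/(lt_le_trans (vmeas_gt0 G x)); rewrite pmulr_lgt0 //.
exact: weight_gt0.
Qed.

Lemma cheeger_ge0 (R : realType) (V : finType) (G : weighted_graph R V)
    (H : structure_group) (d : nat) (sigma : V -> V -> 'M[base_field R H]_d) k :
  (k <= #|V|)%N -> 0 <= cheeger G sigma k.
Proof.
move=> /disjoint_family_exists[S0 hS0]; apply: lb_le_inf.
  by exists (\big[Num.max/0]_(p < k) phi G sigma (S0 p)), S0.
by move=> _ [S _ <-]; exact: bigmax_ge_id.
Qed.

Theorem theorem5p1 (R : realType) (V : finType) (G : weighted_graph R V)
    (H : structure_group) (d : nat)
    (sigma : V -> V -> 'M[base_field R H]_d) :
  (0 < d)%N ->
  (exists x y, adj G x y) ->
  is_signature G sigma ->
  CD0oo G sigma ->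
  forall k : nat, (1 <= k <= #|V|)%N ->
    Num.sqrt (lambda_ G sigma (k * d)) <=
      4 * Num.sqrt (Dnor G)
        * ((k * d)%:R * Num.sqrt (ln (2 * k * d)%:R))
        * cheeger G sigma k.
Proof.
move=> d0 edge sigmaP cd k /andP[k0 kV].
have h0 := cheeger_ge0 G sigma kV.
set Lam := lambda_ _ _ _; have [Lam_le0|Lam_gt0] := leP Lam 0.
  by rewrite (ler0_sqrtr Lam_le0) !mulr_ge0 ?sqrtr_ge0.
have [phi [l [phi_on phi_span phi_eigen]]] := laplacian_eigenbasis sigmaP.
have low : (#|[set j | (l j < Lam)%R]| < k * d)%N.
  rewrite -(prednK (_ : 0 < k * d)%N) ?muln_gt0 ?k0 //.
  exact: (card_eigenvalues_below phi_on phi_eigen).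
pose B := 2 * Num.sqrt (Dnor G) * (k * d)%:R.
have B0 : 0 < B.
  by rewrite !mulr_gt0 ?sqrtr_gt0 ?Dnor_gt0 // ltr0n muln_gt0 k0.
have main : 8 / 13 * Num.sqrt Lam <= B * cheeger G sigma k.
  rewrite [leRHS]mulrC -ler_pdivrMr //; apply: lb_le_inf.
    have [S0 hS0] := disjoint_family_exists kV.
    by exists (\big[Num.max/0]_(p < k) Defs.phi G sigma (S0 p)), S0.
  move=> _ [S hS <-]; rewrite ler_pdivrMr // [leRHS]mulrC /B -[leRHS]mulrA.
  exact: (cheeger_lower_bound sigmaP cd d0 phi_on phi_span phi_eigen hS Lam_gt0 low).
(* (13 / 16)^2 < 2 / 3 <= ln 2: together with the constant 8 / 13 this leaves
   exactly the factor 4. *)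
have log_ge : 13 / 16 <= Num.sqrt (ln (2 * k * d)%:R) :> R.
  have -> : 13 / 16 = Num.sqrt ((13 / 16) ^+ 2) :> R.
    by rewrite sqrtr_sqr ger0_norm.
  apply: ler_wsqrtr; apply: (@le_trans _ _ (2 / 3)); first lra.
  apply: le_trans (ln2_ge R) _; rewrite ler_ln ?posrE ?ltr0n ?muln_gt0 ?k0 //.
  by rewrite ler_nat -mulnA leq_pmulr // muln_gt0 k0.
have -> : 4 * Num.sqrt (Dnor G) * ((k * d)%:R * Num.sqrt (ln (2 * k * d)%:R))
    * cheeger G sigma k = 2 * Num.sqrt (ln (2 * k * d)%:R) * (B * cheeger G sigma k).
  by rewrite /B; ring.
have Bh0 : 0 <= B * cheeger G sigma k by rewrite mulr_ge0 // ltW.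
have := ler_wpM2r Bh0 log_ge; lra.
Qed.
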